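(* Let $Q_0\subset\mathbb{R}^n$ be a cube and let $0<s\le 2^{-n}$. Then $vmo_s(Q_0)=VMO(Q_0)$.
   Context: Cubes have sides parallel to the coordinate axes; $|E|$ is Lebesgue measure; functions are real-valued. For a cube $Q$, $0<t<1$ and a measurable $g$ on $Q$, the maximal median is $$m_g(t,Q)=\sup\{M\in\mathbb{R}: |\{y\in Q: g(y)<M\}|\le t|Q|\}.$$ A measurable function $f$ on $Q_0$ is of vanishing median oscillation with parameter $s$ in $Q_0$, written $f\in vmo_s(Q_0)$, if $$\phi_s(u)=\sup_{Q\subset Q_0,\ |Q|\le u}\ \inf_c\ m_{|f-c|}(1-s,Q)$$ (supremum over cubes $Q$, infimum over real constants $c$) satisfies $\lim_{u\to0^+}\phi_s(u)=0$. $VMO(Q_0)$ is the space of integrable functions $f$ on $Q_0$ of vanishing mean oscillation, i.e. with $$\lim_{u\to0^+}\ \sup_{Q\subset Q_0,\ |Q|\le u}\frac1{|Q|}\int_Q|f(y)-f_Q|\,dy=0,$$ where $f_Q$ is the average of $f$ over $Q$. *)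

(* Defs.v *)
From HB Require Import structures.
From mathcomp Require Import all_boot all_order all_algebra.
From mathcomp Require Import all_classical all_reals all_analysis.

Set Implicit Arguments.
Unset Strict Implicit.
Unset Printing Implicit Defensive.

Import Order.TTheory GRing.Theory Num.Theory.
Import numFieldNormedType.Exports.

Local Open Scope classical_set_scope.
Local Open Scope ring_scope.

(* Points of R^n are n-tuples. The Borel version of the Lebesgue measure on
   R^n is obtained by iterating the product with the one-dimensional Lebesgue
   measure; Lebesgue measure proper is its Caratheodory completion. *)

Section cons_measure.
Context (R : realType) (n : nat).
Notation T := (measurableTypeR R).

Definition tuple_cons (p : T * n.-tuple T) : n.+1.-tuple T :=
  [the n.+1.-tuple T of p.1 :: p.2].

Lemma measurable_tuple_cons : measurable_fun [set: T * n.-tuple T] tuple_cons.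
Proof. exact: measurable_cons. Qed.

Variable m : {sigma_finite_measure set (n.-tuple T) -> \bar R}.

Definition cons_measure : set (n.+1.-tuple T) -> \bar R :=
  pushforward (lebesgue_measure \x m)%E tuple_cons.

Let measurable_preimage_cons A :
  measurable A -> measurable (tuple_cons @^-1` A).
Proof.
by move=> mA; rewrite -[X in measurable X]setTI; exact: measurable_tuple_cons.
Qed.

Let cons_measure0 : cons_measure set0 = 0%E.
Proof. by rewrite /cons_measure /pushforward preimage_set0 measure0. Qed.

Let cons_measure_ge0 A : (0 <= cons_measure A)%E.
Proof. exact: (measure_ge0 (lebesgue_measure \x m)%E). Qed.

Let cons_measure_sigma_additive : semi_sigma_additive cons_measure.
Proof.
move=> F mF tF mUF; rewrite /cons_measure /pushforward preimage_bigcup.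
apply: measure_semi_sigma_additive.
- by move=> k; exact: measurable_preimage_cons.
- apply/trivIsetP => /= i j _ _ ij; rewrite -preimage_setI.
  by move/trivIsetP : tF => /(_ _ _ _ _ ij) ->//; rewrite preimage_set0.
- by rewrite -preimage_bigcup; exact: measurable_preimage_cons.
Qed.

HB.instance Definition _ := isMeasure.Build _ _ _ cons_measure
  cons_measure0 cons_measure_ge0 cons_measure_sigma_additive.

Let cons_measure_sigma_finite : sigma_finite setT cons_measure.
Proof.
have /sigma_finiteP[F [FT ndF mF]] := sigma_finiteT (@lebesgue_measure R).
have /sigma_finiteP[G [GT ndG mG]] := sigma_finiteT m.
pose split (x : n.+1.-tuple T) : T * n.-tuple T :=
  (thead x, [tuple of behead x]).
have msplit : measurable_fun [set: n.+1.-tuple T] split.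
  by apply/measurable_fun_pair; [exact: measurable_tnth|exact: measurable_behead].
have splitK : cancel tuple_cons split.
  by case=> x y; congr pair; exact/val_inj.
exists (fun k => split @^-1` (F k `*` G k)).
  rewrite -preimage_bigcup -[LHS](preimage_setT split); congr preimage.
  rewrite -setXTT FT GT predeqE => -[x y]; split.
    move=> [/= [i _ Fix] [j _ Gjy]]; exists (maxn i j) => //; split.
    - by move: x Fix; exact/subsetPset/ndF/leq_maxl.
    - by move: y Gjy; exact/subsetPset/ndG/leq_maxr.
  by move=> [k _ []/= ? ?]; split; exists k.
move=> k; have [mFk Fkoo] := mF k; have [mGk Gkoo] := mG k; split.
  by rewrite -[X in measurable X]setTI; apply: msplit => //; exact: measurableX.
rewrite /cons_measure /pushforward -comp_preimage.
rewrite (_ : split \o tuple_cons = id); last by apply/funext => x /=.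
by rewrite preimage_id product_measure1E// lte_mul_pinfty// ge0_fin_numE.
Qed.

HB.instance Definition _ := Measure_isSigmaFinite.Build _ _ _ cons_measure
  cons_measure_sigma_finite.

End cons_measure.

Fixpoint borel_lebesgue (R : realType) (n : nat) :
    {sigma_finite_measure set (n.-tuple (measurableTypeR R)) -> \bar R} :=
  match n with
  | 0 => \d_([tuple] : 0.-tuple (measurableTypeR R))
  | n'.+1 => cons_measure (borel_lebesgue R n')
  end.

Definition box (R : realType) n (a b : n.-tuple R) :
    set (n.-tuple (measurableTypeR R)) :=
  [set x : n.-tuple R | forall i, tnth a i <= tnth x i <= tnth b i].

Lemma measurable_box (R : realType) n (a b : n.-tuple R) : measurable (box a b).
Proof.
rewrite (_ : box a b = \big[setI/setT]_(i < n)
    ((fun x => tnth x i) @^-1` `[tnth a i, tnth b i])).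
  apply: bigsetI_measurable => i _; rewrite -[X in measurable X]setTI.
  exact: (@measurable_tnth _ (measurableTypeR R) n i).
rewrite -bigcap_seq; apply/seteqP; split => x /= h i.
  by move=> _; rewrite /= in_itv/= h.
by have := h i (mem_index_enum _); rewrite /= in_itv.
Qed.

Lemma borel_box (R : realType) n (a b : n.-tuple R) :
  (forall i, tnth a i <= tnth b i) ->
  borel_lebesgue R n (box a b) = (\prod_(i < n) (tnth b i - tnth a i))%:E.
Proof.
elim: n a b => [|n IH] a b ab.
  by rewrite big_ord0 /= diracE mem_set//= => -[].
rewrite big_ord_recl/= /cons_measure /pushforward.
case/tupleP: a ab => a0 a; case/tupleP: b => b0 b ab.
have tS (x : R) (y : n.-tuple R) i :
    tnth [tuple of x :: y] (lift ord0 i) = tnth y i.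
  by rewrite !(tnth_nth x).
rewrite (_ : _ @^-1` _ = `[a0, b0] `*` box a b); last first.
  apply/seteqP; split => [[x y] /= h|[x y] /= [h1 h2] i].
    split => [|i]; first by have := h ord0; rewrite in_itv.
    by have := h (lift ord0 i); rewrite !tS.
  case: (unliftP ord0 i) => [j ->|->]; first by rewrite !tS; exact: h2.
  by move: h1; rewrite in_itv.
rewrite product_measure1E//; last exact: measurable_box.
rewrite IH; last by move=> i; have := ab (lift ord0 i); rewrite !tS.
have := ab ord0; rewrite !tnth0 => ab0.
have leb_itv : lebesgue_measure `[a0, b0]%classic = (b0 - a0)%:E.
  rewrite lebesgue_measure_itv/= lte_fin.
  by case: ltgtP ab0 => // ->; rewrite subrr.
rewrite [X in (X * _)%E](_ : _ = (b0 - a0)%:E); last exact: leb_itv.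
by under [in RHS]eq_bigr do rewrite !tS.
Qed.

(* R^n with its sigma-algebra of Lebesgue measurable sets. *)
Definition Rn (R : realType) (n : nat) :=
  caratheodory_type (mu_ext (borel_lebesgue R n)).

HB.instance Definition _ (R : realType) (n : nat) := Measurable.on (Rn R n).

Definition leb (R : realType) (n : nat) : set (Rn R n) -> \bar R :=
  @completed_measure_extension _ _ _ (borel_lebesgue R n).

HB.instance Definition _ (R : realType) (n : nat) := Measure.on (@leb R n).

(* Cubes are closed and nondegenerate (side length l > 0). *)
Definition cube (R : realType) (n : nat) (a : n.-tuple R) (l : R) :
    set (Rn R n) :=
  [set x : n.-tuple R | forall i, tnth a i <= tnth x i <= tnth a i + l].

Lemma leb_cube (R : realType) n (a : n.-tuple R) l : 0 <= l ->
  leb (cube a l) = (l ^+ n)%:E.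
Proof.
move=> l0; pose b := [tuple tnth a i + l | i < n].
have -> : cube a l = box a b.
  by apply/seteqP; split => x /= h i; have := h i; rewrite tnth_mktuple.
rewrite /leb /completed_measure_extension measurable_mu_extE; last first.
  exact: measurable_box.
have ab i : tnth a i <= tnth b i by rewrite tnth_mktuple lerDl.
apply: (etrans (borel_box ab)); congr EFin.
under eq_bigr do rewrite tnth_mktuple addrC addKr.
by rewrite prodr_const card_ord.
Qed.

Definition is_cube (R : realType) (n : nat) (Q : set (Rn R n)) : Prop :=
  exists a l, 0 < l /\ Q = cube a l.

(* The maximal median m_g(t, Q). The supremum is taken in [\bar R]; it is
   finite when 0 < t < 1, g is measurable on Q and Q is a cube. *)
Definition max_median (R : realType) (n : nat) (g : Rn R n -> R) (t : R)
    (Q : set (Rn R n)) : \bar R :=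
  ereal_sup [set M%:E | M in
    [set M : R | (leb (Q `&` [set y | (g y < M)%R]) <= t%:E * leb Q)%E]].

Definition small_subcubes (R : realType) (n : nat) (Q0 : set (Rn R n)) (u : R) :
    set (set (Rn R n)) :=
  [set Q | [/\ is_cube Q, Q `<=` Q0 & (leb Q <= u%:E)%E]].

Definition median_modulus (R : realType) (n : nat) (s : R) (f : Rn R n -> R)
    (Q0 : set (Rn R n)) (u : R) : \bar R :=
  ereal_sup [set ereal_inf [set max_median (fun y => `|f y - c|) (1 - s) Q
                           | c in [set: R]]
            | Q in small_subcubes Q0 u].

Definition vmo (R : realType) (n : nat) (s : R) (Q0 : set (Rn R n)) :
    set (Rn R n -> R) :=
  [set f | measurable_fun Q0 f /\
           median_modulus s f Q0 u @[u --> 0^'+] --> 0%E].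

Definition average (R : realType) (n : nat) (f : Rn R n -> R)
    (Q : set (Rn R n)) : R :=
  (fine (leb Q))^-1 * \int[@leb R n]_(y in Q) f y.

Definition mean_oscillation (R : realType) (n : nat) (f : Rn R n -> R)
    (Q : set (Rn R n)) : \bar R :=
  ((fine (leb Q))^-1%:E * \int[@leb R n]_(y in Q) `|f y - average f Q|%:E)%E.

Definition mean_modulus (R : realType) (n : nat) (f : Rn R n -> R)
    (Q0 : set (Rn R n)) (u : R) : \bar R :=
  ereal_sup [set mean_oscillation f Q | Q in small_subcubes Q0 u].

Definition VMO (R : realType) (n : nat) (Q0 : set (Rn R n)) :
    set (Rn R n -> R) :=
  [set f | (@leb R n).-integrable Q0 (EFin \o f) /\
           mean_modulus f Q0 u @[u --> 0^'+] --> 0%E].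

(* Main.v *)
Require Import Defs.
From mathcomp Require Import all_boot all_order all_algebra.
From mathcomp Require Import all_classical all_reals all_analysis.
From mathcomp Require Import measurable_realfun zify lra.

Set Implicit Arguments.
Unset Strict Implicit.
Unset Printing Implicit Defensive.

Import Order.TTheory GRing.Theory Num.Theory.
Import numFieldNormedType.Exports.

Local Open Scope classical_set_scope.
Local Open Scope ring_scope.

(* VMO is contained in vmo_s by Chebyshev's inequality, with [c] the average.

   For the converse only s <= 1/2 matters.  Let all cubes of [Q] have median
   oscillation below [A], and let [f >= t] fill less than half of [Q].  By
   dyadic Lebesgue density almost every point where [f >= t] lies in a dyadic
   cell which [f >= t] fills at least by half; stop at the first one.  Between
   this cell and its parent there is, by continuity, a cube of which [f >= t]
   fills exactly half.  On more than half of that cube [f] is within [A] of a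
   constant [c], and this set meets both {f >= t} and {f < t}, so c is within
   [A] of [t].  Hence a fixed fraction [kappa] of the parent lies in the layer
   t - 2A <= f < t + 2A, and adding up over disjoint parents
     kappa |{f >= t}| <= |{t - 2A <= f < t + 2A}|.
   Summing over t, t + 2A, t + 4A, ... telescopes and bounds the integral of
   the positive part of [f - t] by a constant times A |Q|.  The same applies to
   [- f], so the mean oscillation of [Q] is at most a constant times [A]. *)

(** * Integrals of deviations from a constant *)

Section integrals_of_deviations.
Context d (T : measurableType d) (R : realType).
Variables (m : {measure set T -> \bar R}) (D : set T) (f : T -> R).
Hypotheses (mD : measurable D) (mf : measurable_fun D f).

Let pospart t x := Num.max (f x - t) 0.
Let negpart t x := Num.max (- f x - t) 0.

Let measurable_pospart t : measurable_fun D (pospart t).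
Proof. by apply: measurable_maxr => //; exact: measurable_funB. Qed.

Let measurable_negpart t : measurable_fun D (negpart t).
Proof.
apply: measurable_maxr => //; apply: measurable_funB => //.
exact: measurable_funN.
Qed.

Lemma measurable_deviation c : measurable_fun D (fun x => `|f x - c|).
Proof. by apply: measurableT_comp => //; exact: measurable_funB. Qed.

(** A discrete layer-cake bound: where [f x > t], the number of levels [t + h * j] reached by [f x]
    exceeds [(f x - t) / h]. *)
Lemma integral_positive_part_le_sum t h : 0 < h ->
  (\int[m]_(x in D) (Num.max (f x - t) 0)%:E <=
    h%:E * \sum_(0 <= j <oo) m (D `&` [set x | (t + h * j%:R <= f x)%R]))%E.
Proof.
move=> h0; have h0' := ltW h0; pose L j := D `&` [set x | (t + h * j%:R <= f x)%R].
have mL j : measurable (L j).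
  rewrite /L (_ : [set x | _] = f @^-1` `[t + h * j%:R, +oo[%classic); first exact: mf.
  by apply/seteqP; split => x /=; rewrite in_itv/= andbT.
have mg j : measurable_fun D (fun x => (h * \1_(L j) x)%:E).
  by apply/measurable_EFinP; apply: measurable_funM => //; exact: measurable_indic.
have g0 j x : (0 <= (h * \1_(L j) x)%:E)%E by rewrite lee_fin mulr_ge0.
apply: (@le_trans _ _ (\int[m]_(x in D) \sum_(0 <= j <oo) (h * \1_(L j) x)%:E)%E).
  apply: ge0_le_integral => //.
  - by move=> x _; rewrite lee_fin le_max lexx orbT.
  - exact/measurable_EFinP/measurable_pospart.
  - exact: ge0_emeasurable_sum.
  move=> x Dx; have [xt|tx] := leP (f x - t) 0; first exact: nneseries_ge0.
  (* The levels [j = 0, ..., N] are all reached, and there are [N + 1] of them. *)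
  pose N := Num.truncn ((f x - t) / h).
  have Nx : f x - t < h * N.+1%:R.
    by rewrite mulrC -ltr_pdivrMr//; exact: truncnS_gt.
  have ge_part : (\sum_(0 <= j < N.+1) (h * \1_(L j) x)%:E <=
      \sum_(0 <= j <oo) (h * \1_(L j) x)%:E)%E.
    exact: nneseries_lim_ge.
  apply: le_trans ge_part; rewrite sumEFin lee_fin -mulr_sumr;
    apply: (le_trans (ltW Nx)).
  rewrite ler_pM2l// (eq_big_nat _ _ (F2 := fun=> 1)).
    by rewrite big_const_nat iter_addr_0 subn0.
  move=> j /andP[_ jN]; rewrite indicE mem_set//; split => //=.
  have : N%:R <= (f x - t) / h by rewrite truncn_le// divr_ge0// ltW.
  have : h * j%:R <= h * N%:R by rewrite ler_pM2l// ler_nat.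
  rewrite ler_pdivlMr//; lra.
rewrite integral_nneseries// -nneseriesZl//.
rewrite (eq_eseriesr (g := fun j => (h%:E * m (L j))%E)) => [|j _].
  exact: lexx.
rewrite (integralZl_indic mD (fun=> L j))//; last by move=> /(le_lt_trans h0');
  rewrite ltxx.
by rewrite integral_indic// setIidl//; exact: subIsetl.
Qed.

(** Beyond distance [A] from [c] the deviation is carried by one of two tails. The lower tail is
    written as a positive part of [- f], so that a one-sided estimate serves for both. *)
Lemma integral_deviation_le_parts c A : 0 <= A ->
  (\int[m]_(x in D) `|f x - c|%:E <= A%:E * m D +
    (\int[m]_(x in D) (Num.max (f x - (c + A)) 0)%:E +
     \int[m]_(x in D) (Num.max (- f x - (- c + A)) 0)%:E))%E.
Proof.
move=> A0.
have mp : measurable_fun D (EFin \o pospart (c + A)) by exact/measurable_EFinP.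
have mn : measurable_fun D (EFin \o negpart (- c + A)) by exact/measurable_EFinP.
have p0 x : (0 <= (pospart (c + A) x)%:E)%E by rewrite lee_fin le_max lexx orbT.
have n0 x : (0 <= (negpart (- c + A) x)%:E)%E by rewrite lee_fin le_max lexx orbT.
rewrite -(ge0_integralD m mD (fun x _ => p0 x) mp (fun x _ => n0 x) mn).
rewrite -integral_cst// -ge0_integralD//; last 2 first.
- by move=> x _; rewrite adde_ge0.
- exact: emeasurable_funD.
apply: ge0_le_integral => //.
- exact/measurable_EFinP/measurable_deviation.
- by apply: emeasurable_funD => //; exact: emeasurable_funD.
move=> x _; rewrite -!EFinD lee_fin /pospart /negpart.
by case: ler0P => _; case: (ltP (f x - _)) => ?; case: (ltP (- f x - _)) => ?; lra.
Qed.

Variables (v c r : R).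
Hypotheses (v0 : 0 < v) (mDv : m D = v%:E).
Hypothesis fc : (\int[m]_(x in D) `|f x - c|%:E <= (r * v)%:E)%E.

Let integrable_cst (k : R) : m.-integrable D (EFin \o cst k).
Proof.
apply/integrableP; split; first exact/measurable_EFinP/measurable_cst.
by rewrite (integral_cst m mD `|k|%:E) mDv -EFinM ltry.
Qed.

Let integrable_deviation : m.-integrable D (EFin \o (fun x => f x - c)).
Proof.
apply/integrableP; split; first by apply/measurable_EFinP; exact: measurable_funB.
by apply: le_lt_trans fc _; rewrite ltry.
Qed.

Lemma integrable_of_deviation : m.-integrable D (EFin \o f).
Proof.
have := integrableD mD integrable_deviation (integrable_cst c).
by apply: eq_integrable => // x _ /=; rewrite -EFinD subrK.
Qed.

(** Replacing [c] by the average [av] adds [|c - av|], itself at most the mean of [|f - c|]; hence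
    the factor 2. *)
Lemma integral_deviation_average_le (av : R) : av = v^-1 * \int[m]_(x in D) f x ->
  (v^-1%:E * \int[m]_(x in D) `|f x - av|%:E <= (2 * r)%:E)%E.
Proof.
move=> avE; pose I := \int[m]_(x in D) `|f x - c|.
have IE : (\int[m]_(x in D) `|f x - c|%:E = I%:E)%E.
  rewrite /I /Rintegral fineK//; apply: integrable_fin_num => //.
  exact: (integrable_norm integrable_deviation).
have Ir : I <= r * v by rewrite -lee_fin -IE.
have {}avE : av * v = \int[m]_(x in D) f x.
  by rewrite avE mulrAC mulVf ?mul1r// gt_eqF.
have dev : `|c - av| * v <= I.
  rewrite -(gtr0_norm v0) -normrM mulrBl avE.
  have -> : c * v = \int[m]_(x in D) cst c x by rewrite Rintegral_cst// mDv.
  rewrite distrC -RintegralB//; last exact: integrable_of_deviation.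
  exact: le_normr_Rintegral.
have : (\int[m]_(y in D) `|f y - av|%:E <= (2 * I)%:E)%E.
  have mE : measurable_fun D (fun y => `|f y - c|%:E)
    by exact/measurable_EFinP/measurable_deviation.
  apply: (@le_trans _ _ (\int[m]_(y in D) (`|f y - c|%:E + cst `|c - av|%:E y))%E).
    apply: ge0_le_integral => //.
    - exact/measurable_EFinP/measurable_deviation.
    - exact: emeasurable_funD.
    by move=> x _; rewrite -EFinD lee_fin (le_trans _ (ler_normD _ _))// addrA subrK.
  rewrite ge0_integralD//; last by move=> x _; rewrite lee_fin.
  rewrite [X in (_ + X)%E](_ : _ = `|c - av|%:E * m D)%E; last exact: integral_cst.
  rewrite IE mDv -EFinM -EFinD lee_fin; lra.
move=> h; apply: (@le_trans _ _ (v^-1%:E * (2 * I)%:E)%E).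
  by apply: lee_wpmul2l => //; rewrite lee_fin invr_ge0 ltW.
by rewrite -EFinM lee_fin mulrC ler_pdivrMr//; lra.
Qed.

End integrals_of_deviations.

(** * Limits at zero, integrability on unions, Chebyshev's inequality *)

Lemma cvg_right0P (R : realType) (g : R -> \bar R) :
  (forall u, 0 < u -> (0 <= g u)%E) ->
  g u @[u --> 0^'+] --> 0%E <->
  forall e : R, 0 < e -> \forall u \near 0^'+, (g u <= e%:E)%E.
Proof.
move=> g0; split => [cg e e0|h].
  have : \forall u \near 0^'+, (g u < e%:E)%E.
    apply: (cg [set y | (y < e%:E)%E]); apply: open_nbhs_nbhs; split.
      exact: open_ereal_lt_ereal.
    by rewrite /= lte_fin.
  by apply: filterS => u /ltW.
apply/fine_cvgP; split.
  (* The bound with [e = 1] makes [g] finite near 0. *)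
  near=> u; rewrite ge0_fin_numE; last by apply: g0; near: u; exact: nbhs_right_gt.
  by apply: (@le_lt_trans _ _ 1%:E); [near: u; exact: h|exact: ltry].
apply/cvgrPdist_le => e e0; near=> u; rewrite sub0r normrN.
have gu0 : (0 <= g u)%E by apply: g0; near: u; exact: nbhs_right_gt.
have gue : (g u <= e%:E)%E by near: u; exact: h.
rewrite ger0_norm ?fine_ge0// -lee_fin fineK// ge0_fin_numE//.
by apply: le_lt_trans gue _; exact: ltry.
Unshelve. all: by end_near. Qed.

Section integrability_and_chebyshev.
Context d (T : measurableType d) (R : realType) (m : {measure set T -> \bar R}).

(** The sets may overlap, as closed subcubes sharing a face do; only the part of [B] outside [A] is
    added to [A]. *)
Lemma integrable_setU (A B : set T) (f : T -> \bar R) :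
  measurable A -> measurable B ->
  m.-integrable A f -> m.-integrable B f -> m.-integrable (A `|` B) f.
Proof.
move=> mA mB /integrableP[mfA fA] /integrableP[mfB fB]; apply/integrableP.
have mU : measurable_fun (A `|` B) f by apply/measurable_funU.
split => //; have mBA : measurable (B `\` A) by exact: measurableD.
have mUa : measurable_fun (A `|` B) (abse \o f) by exact: measurableT_comp.
rewrite -(setDUK (@subsetUl _ A B)) setDUl setDv set0U ge0_integral_setU//.
- apply: lte_add_pinfty => //; apply: le_lt_trans fB.
  apply: ge0_subset_integral => //; exact: measurableT_comp.
- by apply: measurable_funS mUa; [exact: measurableU|move=> x [|[]]; [left|right]].
- by apply/disj_setPRL => x [? ?].
Qed.

Lemma integrable_bigsetU (I : Type) (s : seq I) (F : I -> set T) (f : T -> \bar R) :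
  (forall i, measurable (F i)) -> (forall i, m.-integrable (F i) f) ->
  m.-integrable (\big[setU/set0]_(i <- s) F i) f.
Proof.
move=> mF iF; elim: s => [|i s IH]; first by rewrite big_nil; exact: integrable_set0.
by rewrite big_cons; apply: integrable_setU => //; exact: bigsetU_measurable.
Qed.

(** The bound on the sublevel set says that [M] is admissible in the maximal median with parameter
    [1 - s]; then [g >= M] on a set of measure at least [s * v]. *)
Lemma chebyshev_sublevel (D : set T) (g : T -> R) (M s v : R) :
  measurable D -> measurable_fun D g -> (forall x, D x -> 0 <= g x) ->
  m D = v%:E -> 0 <= M -> 0 <= s ->
  (m (D `&` [set x | (g x < M)%R]) <= ((1 - s) * v)%:E)%E ->
  ((M * (s * v))%:E <= \int[m]_(x in D) (g x)%:E)%E.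
Proof.
move=> mD mg g0 Dv M0 s0 lo.
pose L := D `&` [set x | (g x < M)%R]; pose U := D `\` L.
have mL : measurable L.
  rewrite /L (_ : [set x | _] = g @^-1` `]-oo, M[%classic); first exact: mg.
  by apply/seteqP; split => x /=; rewrite in_itv.
have mU : measurable U by exact: measurableD.
have : ((s * v)%:E <= m U)%E.
  have DI : m D = (m U + m (D `&` L))%E := measureDI m mD mL.
  move: DI lo; rewrite [D `&` L]setIidr; last exact: subIsetl.
  rewrite Dv -/L.
  have : (0 <= m L)%E by exact: measure_ge0.
  case: (m L) => // y _; case: (m U) => // w.
  by rewrite -EFinD !lee_fin => -[?] ?; lra.
move=> svU; rewrite EFinM; apply: (@le_trans _ _ (M%:E * m U)%E).
  by apply: lee_wpmul2l; rewrite ?lee_fin.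
rewrite -integral_cst//; apply: (@le_trans _ _ (\int[m]_(x in U) (g x)%:E)%E).
  apply: ge0_le_integral => //.
  - by apply/measurable_EFinP; apply: measurable_funS mg => // x [].
  move=> x [Dx nL]; rewrite lee_fin leNgt; apply/negP => ?; exact: nL.
apply: ge0_subset_integral => //.
- exact/measurable_EFinP.
- by move=> x []//.
Qed.

End integrability_and_chebyshev.

(** * Refining partitions into cells *)

Section approximation_by_an_algebra.
Context d (T : measurableType d) (R : realType).
Variables (m : {measure set T -> \bar R}) (E : set T) (AA : set (set T)).
Hypotheses (mE : measurable E) (Efin : (m E < +oo)%E).
Hypotheses (AAm : AA `<=` measurable) (AA0 : AA set0).
Hypotheses (AAC : forall A, AA A -> AA (~` A)).
Hypotheses (AAU : forall A B, AA A -> AA B -> AA (A `|` B)).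

(** Both one-sided errors are demanded, which makes the notion invariant under complements. *)
Let approximable : set (set T) := [set A | measurable A /\
  forall e : R, 0 < e -> exists2 B, AA B &
    (m (E `&` (A `\` B)) <= e%:E)%E /\ (m (E `&` (B `\` A)) <= e%:E)%E].

Let approximableU A B :
  approximable A -> approximable B -> approximable (A `|` B).
Proof.
move=> [mA hA] [mB hB]; split; first exact: measurableU.
move=> e e0; have e20 : 0 < e / 2 by rewrite divr_gt0.
have [A' AA' [A1 A2]] := hA _ e20; have [B' AB' [B1 B2]] := hB _ e20.
have mA' := AAm AA'; have mB' := AAm AB'.
exists (A' `|` B'); first exact: AAU.
rewrite [e]splitr EFinD; split.
  apply: le_trans (leeD A1 B1); apply: le_trans (measureU2 _ _ _);
    [|by apply: measurableI => //; apply: measurableD..].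
  apply: le_measure; rewrite ?inE.
  - by apply: measurableI => //; apply: measurableD; exact: measurableU.
  - by apply: measurableU; apply: measurableI => //; apply: measurableD.
  by move=> x /= [Ex [[?|?] /not_orP[? ?]]]; [left|right].
apply: le_trans (leeD A2 B2); apply: le_trans (measureU2 _ _ _);
  [|by apply: measurableI => //; apply: measurableD..].
apply: le_measure; rewrite ?inE.
- by apply: measurableI => //; apply: measurableD; exact: measurableU.
- by apply: measurableU; apply: measurableI => //; apply: measurableD.
by move=> x /= [Ex [[?|?] /not_orP[? ?]]]; [left|right].
Qed.

Let approximable_sigma_algebra : sigma_algebra setT approximable.
Proof.
have app0 : approximable set0.
  split => // e e0; exists set0 => //.
  by rewrite setD0 setI0 measure0 lee_fin ltW.
split => //.
  move=> A [mA hA]; rewrite setTD; split; first exact: measurableC.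
  move=> e e0; have [B AB [B1 B2]] := hA _ e0; exists (~` B); first exact: AAC.
  by rewrite !setDE !setCK [~` A `&` B]setIC [~` B `&` A]setIC -!setDE.
move=> F hF; have mF i : measurable (F i) by have [] := hF i.
have mUF : measurable (\bigcup_k F k) by exact: bigcup_measurable.
split => // e e0; have e20 : 0 < e / 2 by rewrite divr_gt0.
pose U N := \big[setU/set0]_(i < N) F i.
have mU N : measurable (U N) by exact: bigsetU_measurable.
have hU N : approximable (U N).
  rewrite /U; elim: N => [|N IH]; first by rewrite big_ord0.
  by rewrite big_ord_recr/=; exact: approximableU.
(* The tails [V N] decrease to the empty set and [E] has finite measure, so their measures tend to 0
   and a finite union can stand in for the whole one. *)
pose V N := E `&` (\bigcup_k F k `\` U N).
have mV N : measurable (V N) by apply: measurableI => //; exact: measurableD.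
have V0 : \bigcap_N V N = set0.
  rewrite -subset0 => x h; have [_ [[k _ Fkx] _]] := h 0%N I.
  have [_ [_]] := h k.+1 I; apply; rewrite /U big_ord_recr/=; by right.
have : m (V N) @[N --> \oo] --> 0%E.
  rewrite -(measure0 m) -V0; apply: nonincreasing_cvg_mu => //.
  - apply: le_lt_trans Efin; apply: le_measure; rewrite ?inE//.
    exact: subIsetl.
  - by rewrite V0.
  - apply/nonincreasing_seqP => N; apply/subsetPset; apply: setIS.
    by apply: setDS; rewrite /U big_ord_recr; left.
move=> /(_ [set y | (y < (e / 2)%:E)%E]) [].
  apply: open_nbhs_nbhs; split; last by rewrite /= lte_fin.
  exact: open_ereal_lt_ereal.
move=> N _ /(_ N (leqnn N)) /= VN.
have [_ /(_ _ e20)[B AB [B1 B2]]] := hU N; exists B => //.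
have mB := AAm AB; split.
  rewrite [e]splitr EFinD; apply: le_trans (leeD (ltW VN) B1).
  apply: le_trans (measureU2 _ _ _) => //; last first.
    by apply: measurableI => //; exact: measurableD.
  apply: le_measure; rewrite ?inE.
  - by apply: measurableI => //; exact: measurableD.
  - by apply: measurableU => //; apply: measurableI => //; exact: measurableD.
  move=> x [Ex [UFx nBx]]; have [Ux|nUx] := pselect (U N x); [by right|by left].
apply: (@le_trans _ _ (e / 2)%:E); last first.
  by rewrite lee_fin ler_pdivrMr// mulr2n mulrDr mulr1 lerDl ltW.
apply: le_trans B2; apply: le_measure; rewrite ?inE.
- by apply: measurableI => //; exact: measurableD.
- by apply: measurableI => //; exact: measurableD.
apply: setIS; apply: setDS; rewrite /U -bigcup_mkord.
by apply: bigcup_sub => i _ x Fx; exists i.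
Qed.

(** The approximable sets form a sigma-algebra containing [AA]. *)
Lemma algebra_approximation A (e : R) : <<s AA >> A -> 0 < e ->
  exists2 B, AA B &
    (m (E `&` (A `\` B)) <= e%:E)%E /\ (m (E `&` (B `\` A)) <= e%:E)%E.
Proof.
move=> sA e0; suff [_ /(_ e e0)] : approximable A by [].
apply: sA; split => // B AB; split; first exact: AAm.
by move=> e' e'0; exists B => //; rewrite setDv setI0 measure0 lee_fin ltW.
Qed.

End approximation_by_an_algebra.

(* The sets [idx k @^-1` [set c]] are the cells of generation k; each
   generation refines the previous ones. *)
Section refining_cells.
Context d (T : measurableType d) (R : realType) (C : countType).
Variables (m : {measure set T -> \bar R}) (idx : nat -> T -> C).
Hypothesis midx : forall k c, measurable (idx k @^-1` [set c]).
Hypothesis refine : forall k x y, idx k.+1 x = idx k.+1 y -> idx k x = idx k y.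

Lemma refining_le k k' x y : (k <= k')%N -> idx k' x = idx k' y -> idx k x = idx k y.
Proof.
move=> /subnK <-; elim: (k' - k)%N => [//|j IH]; rewrite addSn.
by move=> /refine.
Qed.

Variables (L W : set T) (a : R) (good : nat -> C -> Prop).
Hypotheses (mL : measurable L) (mW : measurable W) (a0 : 0 <= a).
Hypothesis good_le : forall k c, good k c ->
  (a%:E * m (L `&` idx k @^-1` [set c]) <= m (W `&` idx k @^-1` [set c]))%E.

(* Passing to the cells of minimal generation makes the union disjoint. *)
Let minimal k c := good k c /\
  forall x j, idx k x = c -> (j < k)%N -> ~ good j (idx j x).

(** Pairs of a generation and an index are enumerated by [pickle]; the minimal good cells thus form
    a sequence, padded with empty sets, to which countable additivity applies. *)
Let cell j := match pickle_inv j with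
  | Some kc => if `[< minimal kc.1 kc.2 >] then idx kc.1 @^-1` [set kc.2] else set0
  | None => set0 end.

Let mcell j : measurable (cell j).
Proof. by rewrite /cell; case: pickle_inv => // -[k c] /=; case: ifP. Qed.

(** Of two overlapping minimal cells neither can have the earlier generation, by minimality of the
    other; within one generation overlapping cells coincide. *)
Let trivIset_cell : trivIset setT cell.
Proof.
move=> i j _ _ [x []]; rewrite /cell.
have := @pickle_invK (nat * C)%type i; case: pickle_inv => [[k c]|//] /= <-.
case: asboolP => //= -[gkc mkc] kx.
have := @pickle_invK (nat * C)%type j; case: pickle_inv => [[k' c']|//] /= <-.
case: asboolP => //= -[gkc' mkc'] kx'.
have kk' : k = k'.
  apply/eqP; rewrite eqn_leq; apply/andP; split; rewrite leqNgt; apply/negP => lt.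
    by apply: (mkc x k' kx lt); rewrite kx'.
  by apply: (mkc' x k kx' lt); rewrite kx.
by rewrite -kx -kx' kk'.
Qed.

Local Notation V := [set x | exists k, good k (idx k x)].

Let VE : V = \bigcup_j cell j.
Proof.
apply/seteqP; split => [x [k0 gk0]|x [j _]]; last first.
  rewrite /cell; case: pickle_inv => // -[k c] /=.
  by case: asboolP => //= -[gkc _] kx; exists k; rewrite kx.
have exk : exists k, `[< good k (idx k x) >] by exists k0; exact/asboolP.
case: (ex_minnP exk) => k /asboolP gk mink.
(* Points of one cell share all their earlier cells, so the first good generation of [x] is first
   for its whole cell. *)
have mk : minimal k (idx k x).
  split => // y j yx jk gy; have: (k <= j)%N.
    by apply: mink; apply/asboolP; rewrite -(refining_le (ltnW jk) yx).
  by rewrite leqNgt jk.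
by exists (pickle (k, idx k x)) => //; rewrite /cell pickleK_inv/= asboolT.
Qed.

Lemma measurable_cells_union : measurable V.
Proof. by rewrite VE; exact: bigcup_measurable. Qed.

(** By countable additivity the inequality passes from the disjoint minimal good cells to their
    union. *)
Lemma measure_cells_union_le : (a%:E * m (L `&` V) <= m (W `&` V))%E.
Proof.
have mI A : measurable A -> m (A `&` V) = (\sum_(j <oo) m (A `&` cell j))%E.
  move=> mA; rewrite VE setI_bigcupr measure_semi_bigcup//.
  - by move=> j; exact: measurableI.
  - exact: trivIset_setIl.
  - by apply: bigcup_measurable => j _; exact: measurableI.
rewrite !mI// -nneseriesZl//; apply: lee_nneseries => j _.
  by rewrite mule_ge0.
rewrite /cell; case: pickle_inv => [[k c]|]; last by rewrite !setI0 measure0 mule0.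
case: asboolP => /= [[gkc _]|_]; first exact: good_le.
by rewrite !setI0 measure0 mule0.
Qed.

End refining_cells.

Section cell_algebra.
Context d (T : measurableType d) (R : realType) (C : countType).
Variables (m : {measure set T -> \bar R}) (idx : nat -> T -> C).
Hypothesis midx : forall k c, measurable (idx k @^-1` [set c]).
Hypothesis refine : forall k x y, idx k.+1 x = idx k.+1 y -> idx k x = idx k y.

Local Notation AA := [set B : set T | exists k S, B = idx k @^-1` S].

(** This puts a union of cells of generation [k] in the form of [V], with goodness confined to that
    generation. *)
Let cellsE k S : [set x | exists k', k' = k /\ S (idx k' x)] = idx k @^-1` S.
Proof. by apply/seteqP; split => [x [_ [-> ]]//|x Sx]; exists k. Qed.

Lemma measurable_cells k S : measurable (idx k @^-1` S).
Proof.
by rewrite -cellsE; exact: (measurable_cells_union midx refine (fun j c => j = k /\ S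
  c)).
Qed.

Lemma measure_cells_le L W (r : R) k S :
  measurable L -> measurable W -> 0 <= r ->
  (forall c, (r%:E * m (L `&` idx k @^-1` [set c]) <= m (W `&` idx k @^-1` [set
    c]))%E) ->
  (r%:E * m (L `&` idx k @^-1` S) <= m (W `&` idx k @^-1` S))%E.
Proof.
move=> mL mW r0 h; rewrite -cellsE.
by apply: (measure_cells_union_le midx refine (good :=
  fun j c => j = k /\ S c)) => // _ c [-> _].
Qed.

(** Both sets are unions of cells of the finer generation [k']. *)
Let cellsU k k' S S' : (k <= k')%N -> AA (idx k @^-1` S `|` idx k' @^-1` S').
Proof.
move=> kk'; exists k', [set idx k' x | x in idx k @^-1` S `|` idx k' @^-1` S'].
apply/seteqP; split => [x ?|x [y [Sy|Sy] /= yx]]; first by exists x.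
  by left; rewrite /= -(refining_le refine kk' yx).
by right; rewrite /= -yx.
Qed.

(** Since generations refine each other, the unions of cells of a single generation form an
    algebra. *)
Lemma cells_approximation (E A : set T) (e : R) :
  measurable E -> (m E < +oo)%E -> <<s AA >> A -> 0 < e ->
  exists k S, (m (E `&` (A `\` idx k @^-1` S)) <= e%:E)%E /\
              (m (E `&` (idx k @^-1` S `\` A)) <= e%:E)%E.
Proof.
move=> mE Efin sA e0.
suff [_ [k [S ->]] h] : exists2 B, AA B &
    (m (E `&` (A `\` B)) <= e%:E)%E /\ (m (E `&` (B `\` A)) <= e%:E)%E.
  by exists k, S.
apply: algebra_approximation => //.
- by move=> _ [k [S ->]]; exact: measurable_cells.
- by exists 0%N, set0; rewrite preimage_set0.
- by move=> _ [k [S ->]]; exists k, (~` S); rewrite preimage_setC.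
- move=> _ _ [k [S ->]] [k' [S' ->]]; case: (leqP k k') => [|/ltnW] kk'.
    exact: cellsU.
  by rewrite setUC; exact: cellsU.
Qed.

End cell_algebra.

(** * Dyadic cells and Lebesgue density *)

Section half_open_cubes.
Context (R : realType) (n : nat).
Implicit Types (a b x : n.-tuple R) (l h : R).

Lemma borel_measurable_Rn (A : set (n.-tuple (measurableTypeR R))) :
  measurable A -> measurable (A : set (Rn R n)).
Proof. exact: caratheodory_measurable_mu_ext. Qed.

Lemma measurable_cube a l : measurable (cube a l).
Proof.
apply: borel_measurable_Rn; pose b := [tuple tnth a i + l | i < n].
rewrite (_ : cube a l = box a b); first exact: measurable_box.
by apply/seteqP; split => x /= h i; have := h i; rewrite tnth_mktuple.
Qed.

(** Half-open cubes tile the space without overlap, whereas closed ones share faces. *)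
Definition half_open_cube a l : set (Rn R n) :=
  [set x : n.-tuple R | forall i, tnth a i <= tnth x i < tnth a i + l].

Lemma measurable_half_open_cube a l : measurable (half_open_cube a l).
Proof.
apply: borel_measurable_Rn; rewrite (_ : half_open_cube a l =
    \big[setI/setT]_(i < n)
      ((fun x : n.-tuple R => tnth x i) @^-1` `[tnth a i, tnth a i + l[)).
  apply: bigsetI_measurable => i _; rewrite -[X in measurable X]setTI.
  exact: (@measurable_tnth _ (measurableTypeR R) n i).
rewrite -bigcap_seq; apply/seteqP; split => x /= h i.
  by move=> _; rewrite /= in_itv/= h.
by have := h i (mem_index_enum _); rewrite /= in_itv.
Qed.

Lemma half_open_cube_sub a l : half_open_cube a l `<=` cube a l.
Proof. by move=> x /= h i; case/andP: (h i) => -> /ltW ->. Qed.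

Lemma leb_half_open_cube a l : 0 < l -> leb (half_open_cube a l) = (l ^+ n)%:E.
Proof.
move=> l0; apply/eqP; rewrite eq_le; apply/andP; split.
  rewrite -(leb_cube a (ltW l0)); apply: le_measure; rewrite ?inE.
  - exact: measurable_half_open_cube.
  - exact: measurable_cube.
  - exact: half_open_cube_sub.
(* Closed cubes of side [h < l] fit inside; then [h] tends to [l]. *)
have le h : 0 <= h -> h < l -> ((h ^+ n)%:E <= leb (half_open_cube a l))%E.
  move=> h0 hl; rewrite -(leb_cube a h0); apply: le_measure; rewrite ?inE.
  - exact: measurable_cube.
  - exact: measurable_half_open_cube.
  move=> x /= hx i; case/andP: (hx i) => -> /= /le_lt_trans; apply.
  by rewrite ltrD2l.
apply: (@cvge_to_le _ (l^'-) _ _ (fun h : R => (h ^+ n)%:E)).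
  apply: cvg_EFin; first by near=> h.
  by apply: cvg_at_left_filter; exact: exprn_continuous.
near=> h; apply: le.
  by near: h; exact: nbhs_left_ge.
by near: h; exact: nbhs_left_lt.
Unshelve. all: by end_near. Qed.

End half_open_cubes.

Section dyadic_cells.
Context (R : realType) (n : nat) (a : n.-tuple R) (l : R).
Hypothesis l0 : 0 < l.
Implicit Types (k : nat) (x y : Rn R n) (z : {ffun 'I_n -> int}).

Definition dyadic_index k (x : Rn R n) : {ffun 'I_n -> int} :=
  [ffun i => Num.floor ((tnth (x : n.-tuple R) i - tnth a i) / (l / 2 ^+ k))].

Definition dyadic_corner k z : n.-tuple R :=
  [tuple tnth a i + (z i)%:~R * (l / 2 ^+ k) | i < n].

Lemma dyadic_side_gt0 k : 0 < l / 2 ^+ k.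
Proof. by rewrite divr_gt0// exprn_gt0. Qed.

Lemma dyadic_cellE k z :
  dyadic_index k @^-1` [set z] = half_open_cube (dyadic_corner k z) (l / 2 ^+ k).
Proof.
have h0 := dyadic_side_gt0 k.
have eqz x i : (Num.floor ((tnth (x : n.-tuple R) i - tnth a i) / (l / 2 ^+ k)) == z
  i) =
  (tnth (dyadic_corner k z) i <= tnth (x : n.-tuple R) i <
    tnth (dyadic_corner k z) i + l / 2 ^+ k).
  rewrite [LHS]floor_eq tnth_mktuple intrD mulr1z.
  rewrite ler_pdivlMr// ltr_pdivrMr// mulrDl mul1r.
  by rewrite lerBrDl ltrBlDl addrA.
apply/seteqP; split => [x /= xz i|x /= h].
  by rewrite -eqz -xz ffunE.
by apply/ffunP => i; rewrite ffunE; apply/eqP; rewrite eqz.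
Qed.

Lemma measurable_dyadic_cell k z : measurable (dyadic_index k @^-1` [set z]).
Proof. by rewrite dyadic_cellE; exact: measurable_half_open_cube. Qed.

Lemma leb_dyadic_cell k z :
  leb (dyadic_index k @^-1` [set z]) = ((l / 2 ^+ k) ^+ n)%:E.
Proof. by rewrite dyadic_cellE leb_half_open_cube// dyadic_side_gt0. Qed.

(** Halving the side doubles the argument of the floor, and the floor of [2 * u] is twice the floor
    of [u], or one more. *)
Lemma dyadic_indexS k x i :
  2 * dyadic_index k x i <= dyadic_index k.+1 x i <= 2 * dyadic_index k x i + 1.
Proof.
clear l0; rewrite !ffunE.
have -> : (tnth (x : n.-tuple R) i - tnth a i) / (l / 2 ^+ k.+1) =
    2 * ((tnth (x : n.-tuple R) i - tnth a i) / (l / 2 ^+ k)).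
  by rewrite exprS !invfM !invrK [l^-1 * (2 * _)]mulrCA [LHS]mulrCA.
set u := _ / (l / _); have /andP[] := floor_itv u.
rewrite intrD => u1 u2; rewrite floor_ge_int -ltzD1 floor_lt_int.
rewrite !intrD !intrM; apply/andP; split; lra.
Qed.

Lemma dyadic_refine k x y :
  dyadic_index k.+1 x = dyadic_index k.+1 y -> dyadic_index k x = dyadic_index k y.
Proof.
clear l0; move=> xy; apply/ffunP => i; have := dyadic_indexS k x i.
have := dyadic_indexS k y i; rewrite xy.
move: (dyadic_index k.+1 y i) (dyadic_index k x i) (dyadic_index k y i) => u v w.
move=> /andP[? ?] /andP[? ?]. lia.
Qed.

Lemma dyadic_index0 x :
  (dyadic_index 0 x = [ffun=> 0]) <-> half_open_cube a l x.
Proof.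
have -> : (dyadic_index 0 x = [ffun=> 0]) = (dyadic_index 0 @^-1` [set [ffun=> 0]]) x
  by [].
rewrite dyadic_cellE.
rewrite expr0 divr1 (_ : dyadic_corner 0 _ = a)//.
by apply: eq_from_tnth => i; rewrite tnth_mktuple ffunE mul0r addr0.
Qed.

(* [x_i < b] holds iff at some generation the cell of [x] lies to the left of
   the one of [b]. *)
Lemma dyadic_generates (A : set (n.-tuple (measurableTypeR R))) :
  measurable A ->
  <<s [set B : set (Rn R n) | exists k S, B = dyadic_index k @^-1` S] >> A.
Proof.
set G := [set B | _]; apply: smallest_sub; first exact: smallest_sigma_algebra.
rewrite -bigcup_seq => _ [i _ [Y mY <-]]; rewrite setTI.
pose co (x : Rn R n) : R := tnth (x : n.-tuple R) i.
rewrite -[X in <<s _ >> X]/(co @^-1` Y).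
(* The Borel sets of the line are generated by open left rays, so only those need checking. *)
move: mY; rewrite [measurable Y](_ : _ = (@RGenInftyO.G R).-sigma.-measurable Y);
  last by rewrite -RGenInftyO.measurableE.
move: Y; apply: (@smallest_sub _ _ _ [set Y | <<s G >> (co @^-1` Y)]).
  split => /= [|Z hZ|F hF].
  - by rewrite preimage_set0; exact: sigma_algebra0.
  - rewrite setTD preimage_setC -setTD; exact: sigma_algebraCD.
  - by rewrite preimage_bigcup; exact: sigma_algebra_bigcup.
move=> _ [b ->] /=.
pose fl k (t : R) := Num.floor ((t - tnth a i) / (l / 2 ^+ k)).
rewrite (_ : _ @^-1` _ = \bigcup_k (dyadic_index k @^-1` [set z | z i < fl k b])).
  by apply: sigma_algebra_bigcup => k; apply: sub_sigma_algebra;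
    exists k, [set z | z i < fl k b].
apply/seteqP; split => x /=; rewrite in_itv/=.
  (* The generation [k] is chosen so that the side of its cells is below [b - co x]; the rescaled
     coordinates then differ by at least 1 and have different floors. *)
  move=> xb; pose u := l / (b - co x).
  have [k ku] : exists k, u < 2 ^+ k.
    by exists (Num.truncn u).+1; apply: lt_le_trans (truncnS_gt _) _;
      rewrite -natrX ler_nat; apply: ltnW; exact: ltn_expl.
  exists k => //=; rewrite ffunE -/(co x) -/(fl k (co x)).
  have h0 := dyadic_side_gt0 k.
  have : 1 <= (b - tnth a i) / (l / 2 ^+ k) - (co x - tnth a i) / (l / 2 ^+ k).
    rewrite -mulrBl opprB addrA subrK ler_pdivlMr// mul1r.
    rewrite ler_pdivrMr ?exprn_gt0// mulrC -ler_pdivrMr ?subr_gt0//.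
    exact: ltW.
  rewrite /fl floor_lt_int.
  have := floorD1_gt ((b - tnth a i) / (l / 2 ^+ k)); rewrite intrD; lra.
move=> [k _]; rewrite /= ffunE -/(co x) -/(fl k (co x)).
apply: contraTT; rewrite -!leNgt => bx; apply: le_floor.
by rewrite ler_pM2r ?invr_gt0 ?dyadic_side_gt0// lerD2r.
Qed.

End dyadic_cells.

Section dyadic_density.
Context (R : realType) (n : nat) (a : n.-tuple R) (l : R).
Hypothesis l0 : 0 < l.
Local Notation H := (half_open_cube a l).
Local Notation D k z := (dyadic_index a l k @^-1` [set z]).

Lemma leb_borel (A : set (n.-tuple (measurableTypeR R))) : measurable A ->
  leb (A : set (Rn R n)) = borel_lebesgue R n A.
Proof.
by move=> mA; rewrite /leb /completed_measure_extension measurable_mu_extE.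
Qed.

(** [leb] is an outer measure, an infimum over countable Borel covers; [B] is the union of a nearly
    optimal one. *)
Lemma borel_cover (N : set (Rn R n)) (e : R) : leb N \is a fin_num -> 0 < e ->
  exists2 B : set (n.-tuple (measurableTypeR R)), measurable B &
    N `<=` B /\ (leb (B : set (Rn R n)) <= leb N + e%:E)%E.
Proof.
move=> Nfin e0; have [_ [F [mF NF] <-] lte] := lb_ereal_inf_adherent e0 Nfin.
exists (\bigcup_k F k); first exact: bigcup_measurable.
split => //; apply: le_trans (ltW lte).
have mF' k : measurable (F k : set (Rn R n)) by exact: borel_measurable_Rn.
apply: le_trans (measure_sigma_subadditive (leb (n := n)) mF' _ (@subset_refl _ _)) _.
  exact: bigcup_measurable.
apply: lee_nneseries => // k _.
have h : (leb (F k : set (Rn R n)) <= borel_lebesgue R n (F k))%E by rewrite leb_borel.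
exact: h.
Qed.

(* [N] is squeezed between unions of cells, on each of which it has density at
   most 1/2; hence it has at most half its own measure. *)
Lemma null_of_small_dyadic_density (N : set (Rn R n)) :
  measurable N -> N `<=` H ->
  (forall k z, 2%:E * leb (N `&` D k z) <= leb (H `&` D k z))%E -> leb N = 0%E.
Proof.
move=> mN NH dens; have mH : measurable H := measurable_half_open_cube a l.
have Hfin : (leb H < +oo)%E by rewrite leb_half_open_cube// ltry.
have fin A : measurable A -> A `<=` H -> leb A \is a fin_num.
  move=> mA AH; rewrite ge0_fin_numE//; apply: le_lt_trans Hfin.
  by apply: le_measure; rewrite ?inE.
apply/eqP; rewrite eq_le measure_ge0 andbT; apply/lee_addgt0Pr => e e0; rewrite add0e.
(* The errors add up to [2 * leb N <= leb N + 4 * (e / 4)]. *)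
have d0 : 0 < e / 4 by rewrite divr_gt0.
have [B mB [NB leB]] := borel_cover (fin _ mN NH) d0.
have mB' : measurable (B : set (Rn R n)) by exact: borel_measurable_Rn.
have [k [S [BS SB]]] := cells_approximation (measurable_dyadic_cell a l0)
  (@dyadic_refine _ _ a l) mH Hfin (dyadic_generates l0 mB) d0.
set U := _ @^-1` S in BS SB.
have mU : measurable U by exact: (measurable_cells (measurable_dyadic_cell a l0)
  (@dyadic_refine _ _ a l)).
have NU : (2%:E * leb (N `&` U) <= leb (H `&` U))%E.
  by apply: (measure_cells_le (measurable_dyadic_cell a l0) (@dyadic_refine _ _ a l))
    => // c; exact: dens.
have N1 : (leb N <= leb (N `&` U) + (e / 4)%:E)%E.
  rewrite (measureDI (leb (n := n)) mN mU) addeC leeD2l//; apply: le_trans BS.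
  apply: le_measure; rewrite ?inE.
  - exact: measurableD.
  - by apply: measurableI => //; exact: measurableD.
  by move=> x [Nx nUx]; split; [exact: NH|split => //; exact: NB].
have N2 : (leb (H `&` U) <= (e / 4)%:E + (leb N + (e / 4)%:E))%E.
  apply: le_trans (leeD SB leB); apply: le_trans (measureU2 _ _ _) => //.
    apply: le_measure; rewrite ?inE.
    - exact: measurableI.
    - by apply: measurableU => //; apply: measurableI => //; exact: measurableD.
    by move=> x [Hx Ux]; have [Bx|nBx] := pselect (B x); [right|left].
  by apply: measurableI => //; exact: measurableD.
have := le_trans NU N2; move: N1.
have /fineK <- := fin _ mN NH; have /fineK <- : leb (N `&` U) \is a fin_num.
  by apply: fin; [exact: measurableI | move=> x [/NH]].
rewrite -!EFinD -EFinM !lee_fin.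
move: (fine _) (fine _) => x y; lra.
Qed.

End dyadic_density.

(** * Cubes in which a set has density one half *)

Lemma within_continuous_dominated (R : realType) (A : set R) (f g : R -> R) :
  continuous g ->
  (forall x y, A x -> A y -> `|f x - f y| <= `|g x - g y|) ->
  {within A, continuous f}.
Proof.
move=> cg fg; apply/subspace_continuousP => x Ax; apply/cvgrPdist_le => e e0.
rewrite near_withinE; near=> y => Ay; apply: le_trans (fg _ _ Ax Ay) _.
near: y; by have /cvgrPdist_le := cg x; exact.
Unshelve. all: by end_near. Qed.

Section cubes_in_measure.
Context (R : realType) (n : nat).
Implicit Types (a b p q : n.-tuple R) (l h : R) (E : set (Rn R n)).

Lemma le_leb A B : measurable A -> measurable B -> A `<=` B ->
  (leb A <= leb (B : set (Rn R n)))%E.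
Proof. by move=> mA mB AB; apply: le_measure; rewrite ?inE. Qed.

Lemma leb_setDI A B : measurable A -> measurable B ->
  leb A = (leb (A `\` B) + leb (A `&` B : set (Rn R n)))%E.
Proof. exact: measureDI. Qed.

Lemma leb_fin_num E b h : measurable E -> E `<=` cube b h -> leb E \is a fin_num.
Proof.
move=> mE Eb; rewrite ge0_fin_numE//; have [h0|h0] := leP 0 h.
  apply: (@le_lt_trans _ _ (leb (cube b h))); last by rewrite leb_cube// ltry.
  by apply: le_measure; rewrite ?inE//; exact: measurable_cube.
apply: (@le_lt_trans _ _ (leb (cube b 0))); last by rewrite leb_cube// ltry.
apply: le_measure; rewrite ?inE//; first exact: measurable_cube.
move=> x /Eb /= hx i; case/andP: (hx i) => -> /= /le_trans; apply.
by rewrite lerD2l ltW.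
Qed.

(** The closed and the half-open cube have the same finite measure, so they differ by a null set. *)
Lemma leb_setI_half_open E b h : measurable E -> 0 < h ->
  leb (E `&` half_open_cube b h) = leb (E `&` cube b h).
Proof.
move=> mE h0; set H := half_open_cube b h; set Q := cube b h.
have mH : measurable H := measurable_half_open_cube b h.
have mQ : measurable Q := measurable_cube b h.
have HQ : H `<=` Q := @half_open_cube_sub _ _ b h.
have QH0 : leb (Q `\` H) = 0%E.
  have := leb_setDI mQ mH; rewrite [Q `&` H]setIidr// leb_cube ?ltW//.
  rewrite leb_half_open_cube//; case: (leb _) => // r [].
  by move/eqP; rewrite -subr_eq subrr => /eqP <-.
have mEQ := measurableI _ _ mE mQ.
rewrite [RHS](leb_setDI mEQ mH) -!setIA [Q `&` H]setIidr//.
rewrite [X in (X + _)%E](_ : _ = 0%E) ?add0e//.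
apply/eqP; rewrite eq_le measure_ge0 andbT -[leRHS]QH0; apply: le_leb.
- exact: measurableD.
- exact: measurableD.
by move=> x [[_ ?] ?].
Qed.

(* Interpolating linearly between the corners and between the side lengths,
   the density of [E] varies continuously. *)
Lemma cube_of_density_half E p p' l l' : measurable E -> 0 < l' -> l' <= l ->
  (forall i, tnth p i <= tnth p' i) ->
  (forall i, tnth p' i + l' <= tnth p i + l) ->
  (leb (cube p' l') <= 2%:E * leb (E `&` cube p' l'))%E ->
  (2%:E * leb (E `&` cube p l) <= leb (cube p l))%E ->
  exists q h, [/\ l' <= h, cube q h `<=` cube p l &
    (2%:E * leb (E `&` cube q h) = leb (cube q h))%E].
Proof.
move=> mE l'0 l'l pp' p'l dl' dl.
(* [r = 0] gives the small cube and [r = 1] the large one. *)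
pose h (r : R) := (1 - r) * l' + r * l.
pose q (r : R) := [tuple (1 - r) * tnth p' i + r * tnth p i | i < n].
pose v (r : R) := h r ^+ n.
pose f (r : R) := fine (leb (E `&` cube (q r) (h r))).
have h_ge (r : R) : 0 <= r -> l' <= h r by move=> r0; rewrite /h; nra.
have fE (r : R) : leb (E `&` cube (q r) (h r)) = (f r)%:E.
  rewrite /f fineK//; apply: (@leb_fin_num _ (q r) (h r)).
    by apply: measurableI => //; exact: measurable_cube.
  exact: subIsetr.
have vE (r : R) : 0 <= r -> leb (cube (q r) (h r)) = (v r)%:E.
  by move=> r0; rewrite leb_cube// (le_trans (ltW l'0))// h_ge.
have sub (r u : R) : 0 <= r -> r <= u -> cube (q r) (h r) `<=` cube (q u) (h u).
  move=> r0 ru x /= hx i; have := hx i; rewrite !tnth_mktuple /h.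
  have := pp' i; have := p'l i => ? ? /andP[? ?]; apply/andP; split; nra.
(* The cubes grow with [r], so the part in [E] grows by no more than the whole volume; [f] inherits
   continuity from the polynomial [v]. *)
have fv (r u : R) : 0 <= r -> r <= u -> 0 <= f u - f r <= v u - v r.
  move=> r0 ru; have u0 := le_trans r0 ru; have sru := sub _ _ r0 ru.
  have mr := measurable_cube (q r) (h r); have mu := measurable_cube (q u) (h u).
  have D1 : (leb (cube (q u) (h u) `\` cube (q r) (h r)) + (v r)%:E = (v u)%:E)%E.
    by rewrite -!vE// [in RHS](leb_setDI mu mr) [_ `&` cube (q r) (h r)]setIidr.
  have mEr : measurable (E `&` cube (q r) (h r)) by exact: measurableI.
  have mEu : measurable (E `&` cube (q u) (h u)) by exact: measurableI.
  have D2 : (leb (E `&` cube (q u) (h u) `\` (E `&` cube (q r) (h r)))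
      + (f r)%:E = (f u)%:E)%E.
    rewrite -!fE// [in RHS](leb_setDI mEu mEr).
    by rewrite [X in (_ = _ + leb X)%E]setIidr//; exact: setIS.
  have D3 : (leb (E `&` cube (q u) (h u) `\` (E `&` cube (q r) (h r))) <=
      leb (cube (q u) (h u) `\` cube (q r) (h r)))%E.
    apply: le_leb; [exact: measurableD|exact: measurableD|].
    by move=> x [[Ex ux] nr]; split => // rx; apply: nr.
  have D4 : (0 <= leb (E `&` cube (q u) (h u) `\` (E `&` cube (q r) (h r))))%E.
    exact: measure_ge0.
  move: D1 D2 D3 D4; set X := leb (_ `\` _); set Y := leb (_ `\` _).
  move: X Y => [x||] [y||]//; rewrite -!EFinD => -[<-] [<-]; rewrite !lee_fin.
  by rewrite !addrK => -> ->.
have fv' (r u : R) : `[0, 1]%classic r -> `[0, 1]%classic u ->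
    `|f r - f u| <= `|v r - v u|.
  rewrite /= !in_itv/= => /andP[r0 _] /andP[u0 _]; have [ru|/ltW ur] := leP r u.
    by have /andP[? ?] := fv _ _ r0 ru; rewrite distrC [leRHS]distrC !ger0_norm; lra.
  by have /andP[? ?] := fv _ _ u0 ur; rewrite !ger0_norm; lra.
have cv : continuous v.
  move=> r; apply: (@continuous_comp _ _ _ h (fun x => x ^+ n));
    last exact: exprn_continuous.
  apply: cvgD; apply: cvgM; try exact: cvg_cst; last exact: cvg_id.
  by apply: cvgB; [exact: cvg_cst|exact: cvg_id].
have cg : {within `[0, 1], continuous (fun r => f r + f r - v r)}.
  apply: within_continuousB; last exact: continuous_subspaceT.
  by apply: within_continuousD; exact: within_continuous_dominated fv'.
have q0 : q 0 = p'.
  by apply: eq_from_tnth => i; rewrite tnth_mktuple subr0 mul1r mul0r addr0.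
have q1 : q 1 = p.
  by apply: eq_from_tnth => i; rewrite tnth_mktuple subrr mul1r mul0r add0r.
have h0E : h 0 = l' by rewrite /h; lra.
have h1E : h 1 = l by rewrite /h; lra.
(* [2 f - v] is nonnegative at 0 and nonpositive at 1. *)
have [|r] := IVT ler01 cg (v := 0).
  rewrite ge_min le_max; apply/andP; split; apply/orP; [right|left].
    by move: dl; rewrite -q1 -h1E vE// fE -EFinM lee_fin; lra.
  by move: dl'; rewrite -q0 -h0E vE// fE -EFinM lee_fin; lra.
rewrite in_itv/= => /andP[r0 r1] /eqP; rewrite subr_eq0 => /eqP gr.
exists (q r), (h r); split; first exact: h_ge.
  by rewrite -q1 -h1E; exact: sub.
by rewrite fE vE// -EFinM -gr mulr_natl mulr2n.
Qed.

End cubes_in_measure.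

(** * The layer inequality *)

Section median_oscillation_decay.
Context (R : realType) (n : nat) (a : n.-tuple R) (l A : R) (f : Rn R n -> R).
Hypothesis l0 : 0 < l.
Local Notation Q := (cube a l).
Local Notation H := (half_open_cube a l).
Hypothesis mf : measurable_fun Q f.
Hypothesis osc : forall b h, 0 < h -> cube b h `<=` Q -> exists c,
  (leb (cube b h) < 2%:E * leb (cube b h `&` [set x | (`|f x - c| < A)%R]))%E.

Let mQ : measurable Q. Proof. exact: measurable_cube. Qed.
Let mH : measurable H. Proof. exact: measurable_half_open_cube. Qed.
Let HQ : H `<=` Q. Proof. exact: half_open_cube_sub. Qed.

Local Notation superlevel t := (Q `&` [set x : Rn R n | (t <= f x)%R]).
Local Notation layer t := (Q `&` [set x : Rn R n | (t - 2 * A <= f x < t + 2 * A)%R]).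
(** The factor 1/2 is the share of the layer in a cube of density one half; [2 ^- n] is the volume
    ratio of a cell to its parent. *)
Local Notation kappa := ((2^-1 * 2 ^- n)%R : R).

Lemma measurable_preimage_itv (i : interval R) : measurable (Q `&` f @^-1` [set` i]).
Proof. exact: mf. Qed.

Lemma measurable_superlevel t : measurable (superlevel t).
Proof.
rewrite (_ : [set x | t <= f x] = f @^-1` `[t, +oo[%classic).
  exact: measurable_preimage_itv.
by apply/seteqP; split => x /=; rewrite in_itv/= andbT.
Qed.

Lemma measurable_layer t : measurable (layer t).
Proof.
rewrite (_ : [set x | _ <= f x < _] = f @^-1` `[t - 2 * A, t + 2 * A[%classic).
  exact: measurable_preimage_itv.
by apply/seteqP; split => x /=; rewrite in_itv.
Qed.

(* More than half of the cube carries values within [A] of a constant, so this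
   set meets both halves and the constant is within [A] of [t]. *)
Lemma half_density_layer t b h : 0 < h -> cube b h `<=` Q ->
  (2%:E * leb (superlevel t `&` cube b h) = leb (cube b h))%E ->
  (leb (cube b h) <= 2%:E * leb (layer t `&` cube b h))%E.
Proof.
move=> h0 bQ half; have [c lec] := osc h0 bQ.
set G := cube b h `&` _ in lec; set L := superlevel t in half.
have mb : measurable (cube b h) := measurable_cube b h.
have mL : measurable L := measurable_superlevel t.
have mG : measurable G.
  rewrite /G (_ : _ `&` _ = cube b h `&` (Q `&` f @^-1` `]c - A, c + A[%classic)).
    by apply: measurableI => //; exact: measurable_preimage_itv.
  apply/seteqP; split => x /= [bx]; rewrite in_itv/=.
    by rewrite ltr_distl => ?; split => //; split => //; exact: bQ.
  by move=> [_ ?]; split => //; rewrite ltr_distl.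
(* Otherwise [G] lies in the half of the cube outside [L], too small for [lec]; [GnL] is
   symmetric. *)
have GL : exists2 x, G x & L x.
  apply: contrapT => hn; move: lec; rewrite ltNge => /negP; apply.
  apply: (@le_trans _ _ (2%:E * leb (cube b h `\` L)))%E.
    rewrite lee_pmul2l// ?lte_fin//; apply: le_leb => //; first exact: measurableD.
    by move=> x Gx; split; [by case: Gx|move=> Lx; apply: hn; exists x].
  have := leb_setDI mb mL; rewrite -half setIC.
  rewrite [_ `&` L]setIC.
  have : leb (L `&` cube b h) \is a fin_num.
    by apply: (@leb_fin_num _ _ _ b h); [exact: measurableI|exact: subIsetr].
  case: (leb (L `&` _)) => // r _; case: (leb (_ `\` _)) => // u.
  by rewrite -!EFinM -EFinD => -[]; rewrite lee_fin; lra.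
have GnL : exists2 x, G x & ~ L x.
  apply: contrapT => hn; move: lec; rewrite ltNge => /negP; apply.
  rewrite -half lee_pmul2l// ?lte_fin//; apply: le_leb => //.
    exact: measurableI.
  move=> x Gx; split; last by case: Gx.
  by apply: contrapT => nLx; apply: hn; exists x.
apply: le_trans (ltW lec) _; rewrite lee_pmul2l// ?lte_fin//; apply: le_leb => //.
  by apply: measurableI => //; exact: measurable_layer.
have [x [bx]] := GL; rewrite /= ltr_distl => xc [_ /= tx].
have [y [yb]] := GnL; rewrite /= ltr_distl => yc nLy.
have yt : f y < t.
  by rewrite ltNge; apply/negP => ty; apply: nLy; split => //; exact: bQ.
(* Now [t <= f x < c + A] and [c - A < f y < t], so [|c - t| < A], and values within [A] of [c] are
   within [2 * A] of [t]. *)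
move=> z [bz]; rewrite /= ltr_distl => zc; split => //; split; first exact: bQ.
by rewrite /=; move: xc yc zc => /andP[? ?] /andP[? ?] /andP[? ?]; apply/andP; split;
  lra.
Qed.

Local Notation D k z := (dyadic_index a l k @^-1` [set z]).
Let mD k z : measurable (D k z). Proof. exact: measurable_dyadic_cell. Qed.

Let D0 x : H x -> D 0 (dyadic_index a l 0 x) = H.
Proof.
move=> /(dyadic_index0 a l0) x0; apply/seteqP; split => y /=.
  by rewrite /= x0 => /(dyadic_index0 a l0).
by move=> /(dyadic_index0 a l0); rewrite /= x0.
Qed.

Let DH k x : H x -> D k (dyadic_index a l k x) `<=` H.
Proof.
move=> Hx y yx; rewrite -(D0 Hx) /=.
exact: (refining_le (@dyadic_refine _ _ a l) (leq0n k)).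
Qed.

Local Notation corner k x := (dyadic_corner a l k (dyadic_index a l k x)).
Local Notation side k := (l / 2 ^+ k)%R.

Let side_gt0 k : 0 < side k. Proof. exact: dyadic_side_gt0. Qed.
Let sideS k : side k = 2 * side k.+1.
Proof. by rewrite exprS invfM mulrCA mulVKf. Qed.

(** For [x] in [H] each index is an integer from 0 to [2 ^ k - 1], so even the closed cell stays
    inside [Q]. *)
Let corner_cube_sub k x : H x -> cube (corner k x) (side k) `<=` Q.
Proof.
move=> Hx w /= hw i; have := hw i; rewrite tnth_mktuple ffunE.
have s0 := side_gt0 k; have /andP[ax xl] := Hx i.
set u := (_ - _) / _; have u0 : 0 <= Num.floor u.
  by rewrite floor_ge0 divr_ge0// ?subr_ge0// ltW.
have lE : l = 2 ^+ k * side k by rewrite mulrC divfK// expf_neq0.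
have : Num.floor u < 2 ^+ k.
  rewrite floor_lt_int rmorphXn/= /u ltr_pdivrMr// -lE; lra.
rewrite -lezD1 -(ler_int R) intrD rmorphXn/= mulr1z => uk.
have {}u0 : 0 <= (Num.floor u)%:~R :> R by rewrite ler0z.
move=> /andP[w1 w2]; apply/andP; split; first by nra.
apply: (le_trans w2); rewrite -addrA lerD2l [leRHS]lE -[X in _ + X]mul1r -mulrDl.
by rewrite ler_pM2r.
Qed.

Let corner_le k x i : tnth (corner k x) i <= tnth (corner k.+1 x) i.
Proof.
have /andP[+ _] := dyadic_indexS a l k x i; rewrite !tnth_mktuple.
rewrite -(ler_int R) intrM lerD2l (sideS k) => /(ler_wpM2r (ltW (side_gt0 k.+1))).
lra.
Qed.

Let corner_ge k x i :
  tnth (corner k.+1 x) i + side k.+1 <= tnth (corner k x) i + side k.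
Proof.
have /andP[_] := dyadic_indexS a l k x i; rewrite !tnth_mktuple.
rewrite -(ler_int R) intrD intrM mulr1z (sideS k) -!addrA lerD2l.
move=> /(ler_wpM2r (ltW (side_gt0 k.+1))); lra.
Qed.

Let leb_D k z : leb (D k z) = (side k ^+ n)%:E.
Proof. exact: leb_dyadic_cell. Qed.

Let leb_setI_D E k x : measurable E ->
  leb (E `&` D k (dyadic_index a l k x)) = leb (E `&` cube (corner k x) (side k)).
Proof. by move=> mE; rewrite dyadic_cellE// leb_setI_half_open//;
  exact: dyadic_side_gt0. Qed.

(* [k.+1] is the generation at which the density of the superlevel set around
   [x] first reaches 1/2. *)
Lemma stopping_cell_layer t k x : H x ->
  (2%:E * leb (superlevel t `&` D k (dyadic_index a l k x)) <=
    leb (D k (dyadic_index a l k x)))%E ->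
  (leb (D k.+1 (dyadic_index a l k.+1 x)) <=
    2%:E * leb (superlevel t `&` D k.+1 (dyadic_index a l k.+1 x)))%E ->
  (kappa%:E * leb (D k (dyadic_index a l k x)) <=
    leb (layer t `&` D k (dyadic_index a l k x)))%E.
Proof.
move=> Hx; have mL := measurable_superlevel t; have mW := measurable_layer t.
have cD j : leb (D j (dyadic_index a l j x)) = leb (cube (corner j x) (side j)).
  by rewrite leb_D leb_cube// ltW.
rewrite !leb_setI_D// !cD => lo hi.
have le_side : side k.+1 <= side k by rewrite (sideS k) ler_peMl ?ler1n// ltW.
have [q [h [sh qP qE]]] := cube_of_density_half mL (side_gt0 k.+1) le_side
  (corner_le k x) (corner_ge k x) hi lo.
have h0 : 0 < h := lt_le_trans (side_gt0 _) sh.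
have qQ : cube q h `<=` Q := subset_trans qP (corner_cube_sub Hx).
have := half_density_layer h0 qQ qE.
have Wle : (leb (layer t `&` cube q h) <= leb (layer t `&` cube (corner k x) (side
  k)))%E.
  apply: le_leb; [| |exact: setIS].
  - by apply: measurableI => //; exact: measurable_cube.
  - by apply: measurableI => //; exact: measurable_cube.
move: Wle; rewrite (leb_cube _ (ltW h0)) (leb_cube _ (ltW (side_gt0 k))).
have /fineK <- : leb (layer t `&` cube q h) \is a fin_num.
  apply: (@leb_fin_num _ _ _ q h); last exact: subIsetr.
  by apply: measurableI => //; exact: measurable_cube.
move=> Wle; rewrite -!EFinM lee_fin => hw; apply: le_trans Wle.
(* The cube found has at least the child's side, hence at least [2 ^- n] of the parent's volume, and
   the layer fills half of it. *)
rewrite lee_fin (sideS k) exprMn -mulrA mulKf ?expf_neq0//.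
have : side k.+1 ^+ n <= h ^+ n by rewrite lerXn2r// nnegrE ltW.
lra.
Qed.

Lemma superlevel_le_layer t : (2%:E * leb (superlevel t) < leb Q)%E ->
  (kappa%:E * leb (superlevel t) <= leb (layer t))%E.
Proof.
move=> tQ; have mL := measurable_superlevel t; have mW := measurable_layer t.
pose dense k z := (leb (D k z) <= 2%:E * leb (superlevel t `&` D k z))%E.
pose good k z := (kappa%:E * leb (superlevel t `&` D k z) <= leb (layer t `&` D k z))%E.
pose Vd := [set x | exists k, dense k (dyadic_index a l k x)].
pose Vg := [set x | exists k, good k (dyadic_index a l k x)].
have mVd : measurable Vd.
  exact: (measurable_cells_union (measurable_dyadic_cell a l0) (@dyadic_refine _ _ a
    l) dense).
have mVg : measurable Vg.
  exact: (measurable_cells_union (measurable_dyadic_cell a l0) (@dyadic_refine _ _ a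
    l) good).
have kappa0 : 0 <= kappa by rewrite mulr_ge0// invr_ge0 ?exprn_ge0.
set L := superlevel t `&` H.
have LE : leb L = leb (superlevel t).
  by rewrite /L leb_setI_half_open//; congr leb; rewrite setIC setIA setIid.
have mLH : measurable L by exact: measurableI.
(* Every cell meeting the part of [L] outside [Vd] fails to be dense, so that part is null. *)
have N0 : leb (L `\` Vd) = 0%E.
  apply: (null_of_small_dyadic_density l0); first exact: measurableD.
    by move=> x [[_ Hx] _].
  move=> k z; have [[x [[[Lx Hx] nVx] xz]]|nex] :=
    pselect (exists x, (L `\` Vd) x /\ D k z x).
    rewrite -xz; have /negP : ~ dense k (dyadic_index a l k x).
      by move=> dk; apply: nVx; exists k.
    rewrite -ltNge => /ltW => dk.
    rewrite [H `&` _]setIidr; last exact: DH.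
    apply: le_trans dk; rewrite lee_pmul2l// ?lte_fin//; apply: le_leb.
    - by apply: measurableI => //; exact: measurableD.
    - exact: measurableI.
    by move=> y [[[? _] _] ?].
  rewrite (_ : (L `\` Vd) `&` _ = set0) ?measure0 ?mule0//.
  by rewrite -subset0 => x ?; apply: nex; exists x.
have LV : L `&` Vd `<=` Vg.
  move=> x [[Lx Hx] [k0 dk0]].
  have [k dk mink] := ex_minnP (ex_intro (fun k => dense k (dyadic_index a l k x)) k0
    dk0).
  (* The cell of generation 0 is [H], which [tQ] keeps from being dense; so the first dense cell has
     a parent, and by minimality the parent is not dense. *)
  case: k dk mink => [d0 _|k dk mink].
    move: d0; rewrite /dense D0// -/L LE leNgt -[X in (_ < X)%E]/(leb H).
    have -> : leb H = leb Q by rewrite leb_half_open_cube// leb_cube// ltW.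
    by rewrite tQ.
  exists k; apply: le_trans (stopping_cell_layer Hx _ dk).
    apply: lee_wpmul2l; first by rewrite lee_fin.
    apply: le_leb => //; exact: measurableI.
  by apply/ltW; rewrite ltNge; apply/negP => /mink; rewrite ltnn.
have Vgle : (kappa%:E * leb (superlevel t `&` Vg) <= leb (layer t `&` Vg))%E.
  by apply: (measure_cells_union_le (measurable_dyadic_cell a l0) (@dyadic_refine _ _
    a l) (good := good)).
apply: (@le_trans _ _ (leb (layer t `&` Vg))); last first.
  by apply: le_leb => //; exact: measurableI.
apply: le_trans Vgle; apply: lee_wpmul2l; first by rewrite lee_fin.
rewrite -LE (leb_setDI mLH mVd) N0 add0e; apply: le_leb.
- exact: measurableI.
- exact: measurableI.
by move=> x LVx; split; [case: LVx => -[]|exact: LV].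
Qed.

End median_oscillation_decay.

(** * Mean oscillation bounded by median oscillation *)

Section mean_bound.
Context (R : realType) (n : nat) (a : n.-tuple R) (l A : R).
Hypotheses (l0 : 0 < l) (A0 : 0 < A).
Local Notation Q := (cube a l).
Local Notation kappa := ((2^-1 * 2 ^- n)%R : R).

(* With [u j] the measure of [f >= t + 2 A j], the layer inequality reads
   [kappa * u j <= u (j - 1) - u (j + 1)], and its sum over [j] telescopes. *)
Lemma superlevel_sum_le (f : Rn R n -> R) t : measurable_fun Q f ->
  (forall b h, 0 < h -> cube b h `<=` Q -> exists c,
    (leb (cube b h) < 2%:E * leb (cube b h `&` [set x | (`|f x - c| < A)%R]))%E) ->
  (2%:E * leb (Q `&` [set x | (t <= f x)%R]) < leb Q)%E ->
  (\sum_(0 <= j <oo) leb (Q `&` [set x | (t + 2 * A * j%:R <= f x)%R]) <=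
    (2 / kappa)%:E * leb Q)%E.
Proof.
move=> mf osc tQ; pose L j := Q `&` [set x | (t + 2 * A * j%:R <= f x)%R].
have mQ : measurable Q := measurable_cube a l.
have mL j : measurable (L j) by exact: measurable_superlevel.
pose u j := fine (leb (L j)).
have uE j : leb (L j) = (u j)%:E.
  by rewrite /u fineK//; apply: (leb_fin_num (mL j)); exact: subIsetl.
have u_ge0 j : 0 <= u j by rewrite -lee_fin -uE; exact: measure_ge0.
have LS j k : (j <= k)%N -> L k `<=` L j.
  move=> jk x [Qx /= kx]; split => //=; apply: le_trans kx.
  by rewrite lerD2l ler_pM2l ?ler_nat// mulr_gt0.
have u_le j k : (j <= k)%N -> u k <= u j.
  by move=> jk; rewrite -lee_fin -!uE; apply: le_leb => //; exact: LS.
have Q0 : leb Q = (l ^+ n)%:E by rewrite leb_cube// ltW.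
have u0 : 2 * u 0%N < l ^+ n.
  rewrite -lte_fin EFinM -uE -Q0 (_ : L 0%N = Q `&` [set x | (t <= f x)%R])//.
  by rewrite /L mulr0 addr0.
have uS j : kappa * u j.+1 <= u j - u j.+2.
  have := @superlevel_le_layer _ _ a l A f l0 mf osc (t + 2 * A * j.+1%:R).
  rewrite -[_ `&` _]/(L j.+1) uE Q0 -!EFinM lte_fin => /(_ _)/wrap[].
    by apply: le_lt_trans u0; rewrite ler_pM2l// u_le.
  have := leb_setDI (mL j) (mL j.+2).
  rewrite [L j `&` _]setIidr; last exact/LS/leqW.
  (* The levels are [2 * A] apart, so the layer around level [j + 1] is exactly [L j] without
     [L (j + 2)]. *)
  rewrite (_ : L j `\` L j.+2 = Q `&` [set x | (t + 2 * A * j.+1%:R - 2 * A <= f x <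
      t + 2 * A * j.+1%:R + 2 * A)%R]); last first.
    have E1 : t + 2 * A * j.+1%:R - 2 * A = t + 2 * A * j%:R by rewrite -natr1; lra.
    have E2 : t + 2 * A * j.+1%:R + 2 * A = t + 2 * A * j.+2%:R
      by rewrite -[j.+2%:R]natr1; lra.
    rewrite E1 E2; apply/seteqP; split => x /=.
      by move=> [[Qx jx] nx]; split => //; rewrite jx/= ltNge; apply/negP => ?;
        apply: nx.
    by move=> [Qx /andP[jx xj]]; split => // -[_ /=]; rewrite leNgt xj.
  rewrite !uE; case: (leb _) => // w.
  by rewrite -EFinD => -[->]; rewrite lee_fin addrK.
have k0 : 0 < kappa by rewrite mulr_gt0// invr_gt0 exprn_gt0.
have k1 : kappa <= 2^-1.
  by rewrite ler_piMr// invf_le1 ?exprn_gt0// exprn_ege1// ler1n.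
(* Keeping [u J + u (J + 1)] on the left is what lets the differences [u j - u (j + 2)] telescope by
   induction. *)
have sum_le J : kappa * \sum_(0 <= j < J.+1) u j + u J + u J.+1 <= 3 * u 0%N.
  elim: J => [|J IH].
    rewrite big_nat1; have := u_le 0%N 1%N isT.
    have : kappa * u 0%N <= 2^-1 * u 0%N by rewrite ler_wpM2r.
    have := u_ge0 0%N; move: (kappa * _) => z; lra.
  rewrite big_nat_recr//= mulrDr; have := uS J; move: IH.
  move: (kappa * _) (kappa * u _) => y z; lra.
apply: lime_le; first exact: is_cvg_nneseries.
near=> J; under eq_bigr do rewrite -/(L _) uE.
rewrite sumEFin Q0 -EFinM lee_fin; apply: (@le_trans _ _ (\sum_(0 <= j < J.+1) u j)).
  by rewrite big_nat_recr//= lerDl.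
(* As [2 * u 0 < l ^+ n], the bound [3 * u 0] is below [2 * l ^+ n]. *)
rewrite mulrAC ler_pdivlMr// mulrC; have := sum_le J; have := u_ge0 J;
  have := u_ge0 J.+1.
have := exprn_gt0 n l0; move: (kappa * _) => y; lra.
Unshelve. all: by end_near. Qed.

Lemma integral_positive_part_le (f : Rn R n -> R) t : measurable_fun Q f ->
  (forall b h, 0 < h -> cube b h `<=` Q -> exists c,
    (leb (cube b h) < 2%:E * leb (cube b h `&` [set x | (`|f x - c| < A)%R]))%E) ->
  (2%:E * leb (Q `&` [set x | (t <= f x)%R]) < leb Q)%E ->
  (\int[@leb R n]_(x in Q) (Num.max (f x - t) 0)%:E <=
    (4 * A / kappa)%:E * leb Q)%E.
Proof.
move=> mf osc tQ; have mQ : measurable Q := measurable_cube a l.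
have A20 : 0 < 2 * A by rewrite mulr_gt0.
have := integral_positive_part_le_sum (leb (n := n)) mQ mf t A20.
move=> /le_trans; apply.
have -> : (4 * A / kappa)%:E = ((2 * A)%:E * (2 / kappa)%:E)%E.
  by rewrite -EFinM; congr EFin; lra.
rewrite -muleA; apply: lee_wpmul2l; first by rewrite lee_fin ltW.
exact: superlevel_sum_le.
Qed.

(** The constant is the one [osc] gives for [Q] itself; each of the two tails contributes
    [4 / kappa]. *)
Lemma integral_deviation_le (f : Rn R n -> R) : measurable_fun Q f ->
  (forall b h, 0 < h -> cube b h `<=` Q -> exists c,
    (leb (cube b h) < 2%:E * leb (cube b h `&` [set x | (`|f x - c| < A)%R]))%E) ->
  exists c, (\int[@leb R n]_(x in Q) `|f x - c|%:E <=
    ((1 + 8 / kappa) * A)%:E * leb Q)%E.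
Proof.
move=> mf osc; have [c Qc] := osc a l l0 (@subset_refl _ _); exists c.
have mQ : measurable Q := measurable_cube a l.
have mg : measurable_fun Q (fun x => - f x) by exact: measurable_funN.
have oscN b h : 0 < h -> cube b h `<=` Q -> exists c,
    (leb (cube b h) < 2%:E * leb (cube b h `&` [set x | (`|- f x - c| < A)%R]))%E.
  move=> h0 bQ; have [c' h'] := osc b h h0 bQ; exists (- c').
  rewrite (_ : [set x | _] = [set x | (`|f x - c'| < A)%R])//.
  by apply/seteqP; split => x /=; rewrite -opprD normrN.
pose G := Q `&` [set x | (`|f x - c| < A)%R].
have mG : measurable G.
  rewrite /G (_ : _ `&` _ = Q `&` f @^-1` `]c - A, c + A[%classic); first exact: mf.
  by apply/seteqP; split => x /= []; rewrite in_itv/= ltr_distl.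
(* Both tails avoid [G], which fills more than half of [Q]. *)
have low (P : set (Rn R n)) : measurable (Q `&` P) ->
    (forall x, P x -> A <= `|f x - c|) -> (2%:E * leb (Q `&` P) < leb Q)%E.
  move=> mP PA; have QP : Q `&` P `<=` Q `\` G.
    by move=> x [Qx /PA]; rewrite leNgt => /negP nG; split => // -[_ /=].
  have QE : leb Q = (l ^+ n)%:E by rewrite leb_cube// ltW.
  have := leb_setDI mQ mG; rewrite [Q `&` G]setIidr; last exact: subIsetl.
  have := le_leb mP (measurableD mQ mG) QP; move: Qc; rewrite -/G QE.
  have /fineK <- : leb G \is a fin_num by apply: (leb_fin_num mG); exact: subIsetl.
  have /fineK <- : leb (Q `&` P) \is a fin_num.
    by apply: (leb_fin_num mP); exact: subIsetl.
  case: (leb (Q `\` G)) => // r; rewrite -!EFinM -EFinD lee_fin !lte_fin.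
  by move=> ? ? []; lra.
have I1 := integral_positive_part_le (t := c + A) mf osc.
have I2 := integral_positive_part_le (t := - c + A) mg oscN.
have {}I1 := I1 (low _ (measurable_superlevel mf _) _).
have {}I2 := I2 (low _ (measurable_superlevel mg _) _).
apply: le_trans (integral_deviation_le_parts (leb (n := n)) mQ mf c (ltW A0)) _.
apply: (@le_trans _ _ (A%:E * leb Q +
    ((4 * A / kappa)%:E * leb Q + (4 * A / kappa)%:E * leb Q))%E).
  apply: leeD; first exact: lexx.
  apply: leeD.
    by apply: I1 => x /= ?; rewrite ler_normr; apply/orP; left; lra.
  by apply: I2 => x /= ?; rewrite ler_normr; apply/orP; right; lra.
rewrite (leb_cube _ (ltW l0)) -!EFinM -!EFinD lee_fin.
by rewrite -!mulrDl ler_wpM2r ?exprn_ge0 ?(ltW l0)//; lra.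
Qed.

Lemma mean_oscillation_le (f : Rn R n -> R) : measurable_fun Q f ->
  (forall b h, 0 < h -> cube b h `<=` Q -> exists c,
    (leb (cube b h) < 2%:E * leb (cube b h `&` [set x | (`|f x - c| < A)%R]))%E) ->
  (@leb R n).-integrable Q (EFin \o f) /\
  (mean_oscillation f Q <= (2 * ((1 + 8 / kappa) * A))%:E)%E.
Proof.
move=> mf osc; have mQ : measurable Q := measurable_cube a l.
have [c] := integral_deviation_le mf osc.
have QE : leb Q = (l ^+ n)%:E by rewrite leb_cube// ltW.
have ln0 : 0 < l ^+ n by rewrite exprn_gt0.
rewrite QE -EFinM => fc; split; first exact: integrable_of_deviation fc.
rewrite /mean_oscillation QE /=.
apply: (integral_deviation_average_le mQ mf ln0 QE fc).
by rewrite /average QE.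
Qed.

End mean_bound.

(** * The two moduli *)

Section bisection.
Context (R : realType) (n : nat).
Implicit Types (b : n.-tuple R) (h : R).

Let corner b h (e : {ffun 'I_n -> bool}) : n.-tuple R :=
  [tuple tnth b i + (if e i then h / 2 else 0) | i < n].

Lemma cube_bisection b h : 0 < h ->
  cube b h = \big[setU/set0]_(e <- index_enum {ffun 'I_n -> bool}) cube (corner b h
    e) (h / 2).
Proof.
move=> h0; rewrite -bigcup_seq; apply/seteqP; split => [x /= bx|x [e _] /= ex i].
  exists [ffun i => tnth b i + h / 2 <= tnth (x : n.-tuple R) i];
    first exact: mem_index_enum.
  move=> i; rewrite tnth_mktuple ffunE; have := bx i => /andP[b1 b2].
  by case: (leP (tnth b i + h / 2) (tnth (x : n.-tuple R) i)) => ?; apply/andP;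
    split; lra.
have := ex i; rewrite tnth_mktuple => /andP[].
by case: (e i) => ? ?; apply/andP; split; lra.
Qed.

(** A modulus controls small cubes only; [k] bisections carry integrability from them to a large
    cube. *)
Lemma integrable_of_small_subcubes (f : Rn R n -> R) (Q : set (Rn R n)) (d : R) :
  (forall b h, 0 < h -> h <= d -> cube b h `<=` Q ->
    (@leb R n).-integrable (cube b h) (EFin \o f)) ->
  forall k b h, 0 < h -> h <= 2 ^+ k * d -> cube b h `<=` Q ->
    (@leb R n).-integrable (cube b h) (EFin \o f).
Proof.
move=> fd; elim => [|k IH] b h h0; first by rewrite expr0 mul1r; exact: fd.
rewrite exprS => hd bQ; rewrite cube_bisection//.
apply: integrable_bigsetU => e; first exact: measurable_cube.
apply: IH; [by rewrite divr_gt0|lra|].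
apply: subset_trans bQ; rewrite [X in _ `<=` X]cube_bisection// -bigcup_seq.
by move=> x ex; exists e => //=; exact: mem_index_enum.
Qed.

End bisection.

Section moduli.
Context (R : realType) (n : nat) (Q0 : set (Rn R n)).
Hypotheses (n0 : (0 < n)%N) (cQ0 : is_cube Q0).
Implicit Types (f : Rn R n -> R) (u s : R).

Lemma measurable_is_cube Q : is_cube Q -> measurable (Q : set (Rn R n)).
Proof. by move=> [b [h [_ ->]]]; exact: measurable_cube. Qed.

(** In positive dimension a side [h <= 1] satisfies [h ^+ n <= h], so a bound on the side bounds the
    volume. *)
Lemma leb_cube_le b h u : 0 <= h -> h <= 1 -> h <= u ->
  (leb (cube b h : set (Rn R n)) <= u%:E)%E.
Proof.
move=> h0 h1 hu; rewrite leb_cube// lee_fin; apply: le_trans hu.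
exact: ler_iXnr.
Qed.

(** The moduli are suprema in the extended reals; a nonempty index set keeps them from being
    [-oo]. *)
Lemma small_subcube_exists u : 0 < u -> exists Q, small_subcubes Q0 u Q.
Proof.
move=> u0; have [a [l [l0 Q0E]]] := cQ0.
pose h := Num.min l (Num.min 1 u).
have h0 : 0 < h by rewrite !lt_min l0 ltr01.
exists (cube a h); split; first by exists a, h.
  rewrite Q0E => x /= hx i; have /andP[-> /= /le_trans] := hx i; apply.
  by rewrite lerD2l ge_min lexx.
by apply: leb_cube_le; [exact: ltW|rewrite !ge_min lexx orbT|rewrite !ge_min lexx
  !orbT].
Qed.

(** [M = 0] is admissible, its sublevel set being empty. *)
Lemma max_median_ge0 f c s Q : s <= 1 ->
  (0 <= max_median (fun y => `|f y - c|)%R (1 - s)%R Q)%E.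
Proof.
move=> s1; apply: ereal_sup_ubound; exists 0 => //=.
rewrite (_ : _ `&` _ = set0) ?leb0; last first.
  by rewrite -subset0 => x [_ /=]; rewrite normr_lt0.
by rewrite [leLHS](measure0 (leb (n := n))) mule_ge0// lee_fin subr_ge0.
Qed.

Lemma median_modulus_ge0 s f u : s <= 1 -> 0 < u -> (0 <= median_modulus s f Q0 u)%E.
Proof.
move=> s1 /small_subcube_exists[Q sQ]; apply: le_ereal_sup_tmp.
exists (ereal_inf [set max_median (fun y => `|f y - c|)%R (1 - s)%R Q | c in [set: R]]).
  by exists Q.
by apply: le_ereal_inf_tmp => _ [c _ <-]; exact: max_median_ge0.
Qed.

Lemma mean_oscillation_ge0 f Q : (0 <= mean_oscillation f Q)%E.
Proof.
rewrite /mean_oscillation mule_ge0//; last by apply: integral_ge0.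
by rewrite lee_fin invr_ge0 fine_ge0.
Qed.

Lemma mean_modulus_ge0 f u : 0 < u -> (0 <= mean_modulus f Q0 u)%E.
Proof.
move=> /small_subcube_exists[Q sQ]; apply: le_ereal_sup_tmp.
by exists (mean_oscillation f Q); [exists Q|exact: mean_oscillation_ge0].
Qed.

(** With [c] the average, Chebyshev's inequality bounds every admissible [M] by [s^-1] times the
    mean oscillation. *)
Lemma median_modulus_le_mean_modulus s f u : 0 < s -> measurable_fun Q0 f ->
  (median_modulus s f Q0 u <= s^-1%:E * mean_modulus f Q0 u)%E.
Proof.
move=> s0 mf; apply: ge_ereal_sup => _ [Q sQ <-]; apply: ge_ereal_inf.
exists (max_median (fun y => `|f y - average f Q|) (1 - s) Q);
  first by exists (average f Q).
apply: (@le_trans _ _ (s^-1%:E * mean_oscillation f Q)%E); last first.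
  apply: lee_wpmul2l; first by rewrite lee_fin invr_ge0 ltW.
  by apply: ereal_sup_ubound; exists Q.
have [[b [h [h0 QE]]] QQ0 _] := sQ.
have mQ : measurable Q by rewrite QE; exact: measurable_cube.
have v0 : 0 < h ^+ n by rewrite exprn_gt0.
have Qv : leb Q = (h ^+ n)%:E by rewrite QE leb_cube// ltW.
apply: ge_ereal_sup => _ [M /= lo <-]; rewrite Qv -EFinM in lo.
have [M0|M0] := leP M 0.
  apply: (@le_trans _ _ 0%E); first by rewrite lee_fin.
  by rewrite mule_ge0 ?mean_oscillation_ge0// lee_fin invr_ge0 ltW.
have mg : measurable_fun Q (fun y => `|f y - average f Q|).
  apply: measurable_deviation => //.
  by apply: measurable_funS mf => //; exact: measurable_is_cube.
have := chebyshev_sublevel mQ mg (fun x _ => normr_ge0 _) Qv (ltW M0) (ltW s0) lo.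
rewrite /mean_oscillation Qv /=; set I := integral _ _ _ => cheb.
have -> : M%:E = ((s^-1)%:E * ((h ^+ n)^-1%:E * (M * (s * h ^+ n))%:E))%E.
  rewrite -!EFinM; congr EFin; rewrite [M * _]mulrCA [_^-1 * (s * _)]mulrCA.
  by rewrite mulKf ?gt_eqF// mulrC mulfK ?gt_eqF.
by do 2 (apply: lee_wpmul2l; first by rewrite lee_fin invr_ge0 ltW).
Qed.

(** A median below [A] means that [A] is not admissible, so the set where [|f - c| < A] exceeds the
    fraction [1 - s >= 1/2] of the cube. *)
Lemma osc_of_median_modulus s f u A b h : 0 < s -> s <= 2^-1 ->
  (median_modulus s f Q0 u < A%:E)%E -> 0 < h -> cube b h `<=` Q0 ->
  (leb (cube b h) <= u%:E)%E -> exists c,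
  (leb (cube b h) < 2%:E * leb (cube b h `&` [set x | (`|f x - c| < A)%R]))%E.
Proof.
move=> s0 s2 phiA h0 bQ0 bu; set Q := cube b h.
have sQ : small_subcubes Q0 u Q by split => //; exists b, h.
have /ereal_inf_lt[_ [c _ <-] cA] :
    (ereal_inf [set max_median (fun y => `|f y - c|)%R (1 - s)%R Q | c in [set: R]] <
      A%:E)%E.
  by apply: le_lt_trans phiA; apply: ereal_sup_ubound; exists Q.
exists c; have Qv : leb Q = (h ^+ n)%:E by rewrite leb_cube// ltW.
have : ~ (leb (Q `&` [set x | (`|f x - c| < A)%R]) <= (1 - s)%:E * leb Q)%E.
  move=> lo; move: cA; rewrite ltNge => /negP; apply.
  by apply: ereal_sup_ubound; exists A.
move=> /negP; rewrite -ltNge Qv -EFinM; set m := leb _.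
have v0 : 0 < h ^+ n by rewrite exprn_gt0.
have : (1 - s) * h ^+ n >= 2^-1 * h ^+ n by rewrite ler_pM2r//; lra.
case: m => [m||].
- by rewrite -EFinM !lte_fin; lra.
- by rewrite gt0_muley ?lte_fin// !ltry.
- by rewrite ltNge leNye.
Qed.

End moduli.

(** * The two inclusions between the spaces *)

Theorem mainTheorem5 (R : realType) (n : nat) (Q0 : set (Rn R n)) (s : R) :
  (0 < n)%N -> is_cube Q0 -> 0 < s -> s <= 2 ^- n ->
  vmo s Q0 = VMO Q0.
Proof.
move=> n0 cQ0 s0 s2n.
have s2 : s <= 2^-1.
  apply: le_trans s2n _; rewrite lef_pV2 ?posrE ?exprn_gt0//.
  by rewrite -[leLHS]expr1 ler_weXn2l ?ler1n.
have s1 : s <= 1 by apply: le_trans s2 _; rewrite invf_le1 ?ler1n.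
(* [C * A] is the bound of [mean_oscillation_le]. *)
pose C : R := 2 * (1 + 8 / (2^-1 * 2 ^- n)).
have C0 : 0 < C.
  by rewrite mulr_gt0// ltr_wpDr// divr_ge0// mulr_ge0// invr_ge0 exprn_ge0.
apply/seteqP; split => f [mf cf]; last first.
  have {}mf : measurable_fun Q0 f by apply/measurable_EFinP; case/integrableP: mf.
  split => //; apply/(cvg_right0P (fun u => median_modulus_ge0 n0 cQ0 f s1)) => e e0.
  (* The target [s * e] absorbs the factor [s^-1]. *)
  move/(cvg_right0P (mean_modulus_ge0 n0 cQ0 f)): cf => /(_ (s * e)).
  rewrite mulr_gt0// => /(_ isT); apply: filterS => u mu.
  apply: (@le_trans _ _ (s^-1%:E * mean_modulus f Q0 u)%E).
    exact: median_modulus_le_mean_modulus.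
  apply: (@le_trans _ _ (s^-1%:E * (s * e)%:E)%E).
    by apply: lee_wpmul2l => //; rewrite lee_fin invr_ge0 ltW.
  by rewrite -EFinM mulKf// gt_eqF.
have mQ0 := measurable_is_cube cQ0.
have key u A b h : 0 < A -> (median_modulus s f Q0 u < A%:E)%E -> 0 < h ->
    cube b h `<=` Q0 -> (leb (cube b h : set (Rn R n)) <= u%:E)%E ->
    (@leb R n).-integrable (cube b h) (EFin \o f) /\
    (mean_oscillation f (cube b h) <= (C * A)%:E)%E.
  move=> A0 phiA h0 bQ0 bu; rewrite -mulrA.
  apply: mean_oscillation_le => //; first exact: measurable_funS mf.
  move=> b' h' h'0 b'b; apply: osc_of_median_modulus phiA _ _ _ => //.
    exact: subset_trans bQ0.
  apply: le_trans bu; apply: le_leb => //; exact: measurable_cube.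
move/(cvg_right0P (fun u => median_modulus_ge0 n0 cQ0 f s1)): cf => cf.
split.
  have half0 : 0 < 2^-1 :> R by rewrite invr_gt0.
  have [u [u0 phiu]] := filter_ex (filterI (nbhs_right_gt (0 : R)) (cf _ half0)).
  have [a [l [l0 Q0E]]] := cQ0; pose d := Num.min 1 u.
  have d0 : 0 < d by rewrite lt_min ltr01.
  (* [l / d < k <= 2 ^ k], so [k] bisections bring the side down to [d], where the volume is at most
     [u]. *)
  pose k := (Num.truncn (l / d)).+1.
  rewrite Q0E; apply: (@integrable_of_small_subcubes _ _ f Q0 d _ k) => //.
  - move=> b h h0 hd bQ0.
    have phi1 : (median_modulus s f Q0 u < 1%:E)%E.
      by apply: le_lt_trans phiu _; rewrite lte_fin invf_lt1 ?ltr1n.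
    have bu : (leb (cube b h : set (Rn R n)) <= u%:E)%E.
      by move: hd; rewrite le_min => /andP[h1 hu]; apply: leb_cube_le => //; exact: ltW.
    by have [] := key u 1 b h ltr01 phi1 h0 bQ0 bu.
  - rewrite -ler_pdivrMr//; apply: le_trans (ltW (truncnS_gt _)) _.
    by rewrite -natrX ler_nat ltnW// ltn_expl.
  - by rewrite Q0E.
apply/(cvg_right0P (mean_modulus_ge0 n0 cQ0 f)) => e e0.
have A0 : 0 < e / C by rewrite divr_gt0.
(* The half leaves the modulus strictly below [e / C], as [key] requires. *)
have A20 : 0 < e / C / 2 by rewrite divr_gt0.
apply: filterS (cf _ A20) => u phiu;
  apply: ge_ereal_sup => _ [Q [[b [h [h0 ->]]] bQ0 bu] <-].
have phiA : (median_modulus s f Q0 u < (e / C)%:E)%E.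
  by apply: le_lt_trans phiu _; rewrite lte_fin; lra.
have [_] := key u (e / C) b h A0 phiA h0 bQ0 bu.
by rewrite mulrC divfK// gt_eqF.
Qed.
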